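(* Let $\alpha_0,\alpha_1,\alpha_2$ be complex parameters with $\alpha_0+2\alpha_1+3\alpha_2=1$, and consider the system $$\frac{dx}{dt}=4x^3y+2(\alpha_0+2\alpha_1)x^2+2tx+1,$$ $$\frac{dy}{dt}=-6x^2y^2-4(\alpha_0+2\alpha_1)xy-2ty-2\alpha_1(\alpha_0+\alpha_1).$$ This system admits extended affine Weyl group symmetry of type $G_2^{(1)}$ as the group of its Bäcklund transformations, whose generators are explicitly given as follows: \begin{align*} s_0:&\ (x,y,t;\alpha_0,\alpha_1,\alpha_2)\to (x,\,y,\,t;\,-\alpha_0,\alpha_1+\alpha_0,\alpha_2),\\ s_1:&\ (x,y,t;\alpha_0,\alpha_1,\alpha_2)\to \left(x+\frac{\alpha_1}{y},\,y,\,t;\,\alpha_0+\alpha_1,-\alpha_1,\alpha_2+\alpha_1\right),\\ s_2:&\ (x,y,t;\alpha_0,\alpha_1,\alpha_2)\to \left(\sqrt{-1}\,x,\,-\sqrt{-1}\Big(y-\frac{3\alpha_2}{x}+\frac{t}{x^2}+\frac{1}{2x^3}\Big),\,-\sqrt{-1}\,t;\,\alpha_0,\alpha_1+3\alpha_2,-\alpha_2\right). \end{align*}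
   Context: Here $x$ and $y$ are unknown complex variables depending on $t$. The system is Hamiltonian, $\frac{dx}{dt}=\frac{\partial H}{\partial y}$, $\frac{dy}{dt}=-\frac{\partial H}{\partial x}$, with polynomial Hamiltonian $H=2x^3y^2+2(\alpha_0+2\alpha_1)x^2y+2txy+2\alpha_1(\alpha_0+\alpha_1)x+y$. The list of generators is read componentwise, e.g. $s_1(x)=x+\frac{\alpha_1}{y}$, $s_1(y)=y$, $s_1(t)=t$, $s_1(\alpha_0)=\alpha_0+\alpha_1$, $s_1(\alpha_1)=-\alpha_1$, $s_1(\alpha_2)=\alpha_2+\alpha_1$. A Bäcklund transformation of the system is a transformation of the variables $(x,y,t)$ and parameters $(\alpha_0,\alpha_1,\alpha_2)$ that carries the system to the system of the same form in the transformed variables with the transformed parameters.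
   Formalization: Since s_2² sends (x,y,t) to (−x,−y,−t), not the identity, the generated group is not the usual extended affine Weyl group of G_2^(1); ''extended'' is read as the extension of W(G_2^(1)) by the central order-2 group {1, s_2²}, with W acting faithfully on the parameters. *)

(* Defs.v *)
From HB Require Import structures.
From mathcomp Require Import all_boot all_order all_algebra.
From mathcomp Require Import all_classical all_reals all_analysis.
From mathcomp Require Import complex.
(* The notations of [mpoly] clash with those of MathComp-Analysis, so that only
   its canonical instances are imported. *)
From mathcomp Require mpoly.
Import (canonicals) mpoly.

Set Implicit Arguments.
Unset Strict Implicit.
Unset Printing Implicit Defensive.

Import Order.TTheory GRing.Theory Num.Theory.
Import numFieldNormedType.Exports.

Local Open Scope classical_set_scope.
Local Open Scope ring_scope.

(* Values of (x, y, t; alpha_0, alpha_1, alpha_2).  They are taken in the complex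
   numbers when solutions are considered, and in a field of rational functions
   when transformations are. *)
Record phase (F : Type) := Phase {
  px : F; py : F; pt : F; pa0 : F; pa1 : F; pa2 : F }.

Definition map_phase (A B : Type) (f : A -> B) (v : phase A) : phase B :=
  Phase (f (px v)) (f (py v)) (f (pt v)) (f (pa0 v)) (f (pa1 v)) (f (pa2 v)).

Definition dxdt (F : fieldType) (v : phase F) : F :=
  let: Phase x y t a0 a1 a2 := v in
  4 * x ^+ 3 * y + 2 * (a0 + 2 * a1) * x ^+ 2 + 2 * t * x + 1.

Definition dydt (F : fieldType) (v : phase F) : F :=
  let: Phase x y t a0 a1 a2 := v in
  - (6 * x ^+ 2 * y ^+ 2) - 4 * (a0 + 2 * a1) * x * y - 2 * t * y
  - 2 * a1 * (a0 + a1).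

Inductive node := n0 | n1 | n2.

(* [I] stands for the square root of -1 in [F]. *)
Definition bt (F : fieldType) (I : F) (k : node) (v : phase F) : phase F :=
  let: Phase x y t a0 a1 a2 := v in
  match k with
  | n0 => Phase x y t (- a0) (a1 + a0) a2
  | n1 => Phase (x + a1 / y) y t (a0 + a1) (- a1) (a2 + a1)
  | n2 => Phase (I * x)
            (- I * (y - 3 * a2 / x + t / x ^+ 2 + 1 / (2 * x ^+ 3)))
            (- I * t) a0 (a1 + 3 * a2) (- a2)
  end.

Definition bt_dom (F : fieldType) (k : node) (v : phase F) : Prop :=
  match k with
  | n0 => True
  | n1 => py v != 0
  | n2 => px v != 0
  end.

Section Solutions.
Variable C : numClosedFieldType.

(* [is_derive t 1] is the derivative with respect to a variable in [C], hence
   the complex derivative when [C] is the field of complex numbers. *)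
Definition solution (U : set C) (a0 a1 a2 : C) (x y : C -> C) : Prop :=
  open U /\
  forall t, U t ->
    is_derive t (1 : C) x (dxdt (Phase (x t) (y t) t a0 a1 a2)) /\
    is_derive t (1 : C) y (dydt (Phase (x t) (y t) t a0 a1 a2)).

(* The transformed solution (X, Y) is a function of the transformed time. *)
Definition carries_solutions (T : phase C -> phase C)
    (dom : phase C -> Prop) : Prop :=
  forall (U : set C) (a0 a1 a2 : C) (x y : C -> C),
    let curve t := Phase (x t) (y t) t a0 a1 a2 in
    let time t := pt (T (curve t)) in
    a0 + 2 * a1 + 3 * a2 = 1 ->
    solution U a0 a1 a2 x y ->
    (forall t, U t -> dom (curve t)) ->
    exists (b0 b1 b2 : C) (X Y : C -> C),
      [/\ b0 + 2 * b1 + 3 * b2 = 1,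
          solution (time @` U) b0 b1 b2 X Y &
          forall t, U t ->
            T (curve t) = Phase (X (time t)) (Y (time t)) (time t) b0 b1 b2].

End Solutions.

Section Transformations.
Variable C : numClosedFieldType.

(* The field of rational functions in x, y, t, alpha_0, alpha_1, alpha_2 subject
   to alpha_0 + 2 alpha_1 + 3 alpha_2 = 1; the independent variables are
   x, y, t, alpha_1, alpha_2, in this order. *)
Definition ratfun : fieldType := {fraction (mpoly.mpoly 5 C)}.

Definition ratcst (c : C) : ratfun := FracField.tofrac (mpoly.mpolyC 5 c).

Definition ratvar (i : 'I_5) : ratfun :=
  FracField.tofrac (mpoly.mpolyX C (mpoly.mnm1 i)).

Definition xi : 'I_5 := @Ordinal 5 0 isT.
Definition yi : 'I_5 := @Ordinal 5 1 isT.
Definition ti : 'I_5 := @Ordinal 5 2 isT.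
Definition a1i : 'I_5 := @Ordinal 5 3 isT.
Definition a2i : 'I_5 := @Ordinal 5 4 isT.

Definition coords : phase ratfun :=
  Phase (ratvar xi) (ratvar yi) (ratvar ti)
        (1 - 2 * ratvar a1i - 3 * ratvar a2i) (ratvar a1i) (ratvar a2i).

(* The quotient rule on a representing fraction n / d. *)
Definition pderiv (i : 'I_5) (f : ratfun) : ratfun :=
  let: (n, d) := frac (generic_quotient.repr f) in
  FracField.tofrac (mpoly.mderiv i n * d - n * mpoly.mderiv i d)
  / FracField.tofrac d ^+ 2.

(* The derivative d/dt along the system, x and y being functions of t and the
   parameters being constants. *)
Definition ddt (f : ratfun) : ratfun :=
  pderiv ti f + dxdt coords * pderiv xi f + dydt coords * pderiv yi f.

Definition param_only (f : ratfun) : Prop :=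
  [/\ pderiv xi f = 0, pderiv yi f = 0 & pderiv ti f = 0].

(* Transformations act on rational functions as automorphisms over [C].  Such an
   automorphism [f] sends the coordinates to the transformed variables
   (X, Y, T; A_0, A_1, A_2); the system for these is
   dX/dt = (right-hand side at (X, Y, T; A_0, A_1, A_2)) * dT/dt, and likewise
   for Y.  The relation A_0 + 2 A_1 + 3 A_2 = 1 is inherited from [coords]. *)
Definition Backlund (f : ratfun -> ratfun) : Prop :=
  [/\ GRing.zmod_morphism f, GRing.monoid_morphism f, bijective f &
      forall c : C, f (ratcst c) = ratcst c] /\
  let v := map_phase f coords in
  [/\ [/\ param_only (pa0 v), param_only (pa1 v) & param_only (pa2 v)],
      ddt (pt v) != 0,
      ddt (px v) = dxdt v * ddt (pt v) &
      ddt (py v) = dydt v * ddt (pt v)].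

Inductive generated (s : node -> ratfun -> ratfun) :
    (ratfun -> ratfun) -> Prop :=
| generated_gen k : generated s (s k)
| generated_id : generated s id
| generated_comp f g : generated s f -> generated s g -> generated s (f \o g)
| generated_inv f g :
    generated s f -> cancel f g -> cancel g f -> generated s g.

Definition word_act (s : node -> ratfun -> ratfun) (w : seq node) :
    ratfun -> ratfun :=
  foldr (fun k f => s k \o f) id w.

Definition same_params (f g : ratfun -> ratfun) : Prop :=
  [/\ f (pa0 coords) = g (pa0 coords), f (pa1 coords) = g (pa1 coords) &
      f (pa2 coords) = g (pa2 coords)].

End Transformations.

(* The Coxeter matrix of the affine Weyl group of type G_2^(1); its Dynkin
   diagram is 0 - 1 (simple edge), 1 - 2 (triple edge). *)
Definition coxeter_G2aff (i j : node) : nat :=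
  match i, j with
  | n0, n0 | n1, n1 | n2, n2 => 1
  | n0, n1 | n1, n0 => 3
  | n1, n2 | n2, n1 => 6
  | n0, n2 | n2, n0 => 2
  end.

(* Equality of words in the affine Weyl group W(G_2^(1)), presented by the
   relations (r_i r_j)^m_ij = 1. *)
Inductive weyl_eq : seq node -> seq node -> Prop :=
| weyl_refl w : weyl_eq w w
| weyl_sym w w' : weyl_eq w w' -> weyl_eq w' w
| weyl_trans w w' w'' : weyl_eq w w' -> weyl_eq w' w'' -> weyl_eq w w''
| weyl_rel u v i j :
    weyl_eq (u ++ flatten (nseq (coxeter_G2aff i j) [:: i; j]) ++ v) (u ++ v).

(* The transformations [s k] generate an extension of W(G_2^(1)), in which
   [s k] lies over the simple reflection r_k, by the central subgroup
   {1, s_2 o s_2} of order 2; moreover the parameters are transformed by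
   W(G_2^(1)) itself, faithfully.  The extension is not W(G_2^(1)): s_2 has
   order 4, as s_2 o s_2 is (x, y, t) -> (-x, -y, -t). *)
Definition extended_affine_Weyl_G2 (C : numClosedFieldType)
    (s : node -> ratfun C -> ratfun C) : Prop :=
  let c := s n2 \o s n2 in
  [/\ [/\ s n0 \o s n0 = id, s n1 \o s n1 = id,
          s n0 \o s n1 \o s n0 = s n1 \o s n0 \o s n1,
          s n0 \o s n2 = s n2 \o s n0 &
          s n1 \o s n2 \o s n1 \o s n2 \o s n1 \o s n2 =
          s n2 \o s n1 \o s n2 \o s n1 \o s n2 \o s n1],
      [/\ map_phase c (coords C) =
            (let: Phase x y t a0 a1 a2 := coords C in
             Phase (- x) (- y) (- t) a0 a1 a2),
          c <> id, c \o c = id &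
          forall g, generated s g -> c \o g = g \o c],
      forall g, generated s g <-> exists w, g = word_act s w,
      forall w w', weyl_eq w w' <->
        word_act s w = word_act s w' \/ word_act s w = word_act s w' \o c &
      forall w w', weyl_eq w w' <->
        same_params (word_act s w) (word_act s w')].

(* Main.v *)
(* Each transformation is a substitution of rational functions.  As a map of
   phase values it has order dividing 4, so that the substitution has a left
   inverse defined where denominators survive; hence it is injective and extends
   to an automorphism.  An automorphism f carries the system to itself if and
   only if the two derivations z |-> d/dt (f z) and z |-> f (dz/dt) * d/dt (f t)
   along f coincide, which makes Backlund transformations closed under
   composition.

   The action on words is contravariant, so that the relations are identities
   between iterates of [bt] at the generic point.  The braid relation of length 6
   holds exactly, and its square gives (s_1 s_2)^6 = s_2^2 = c.

   For the faithfulness on the parameters, put X = 010212 and Y = 021201.  In the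
   presented group X and Y commute, r_1 and r_2 normalize the lattice that they
   generate, and r_0 = X Y r_1 r_2 r_1 r_2 r_1; hence every element is X^a Y^b d
   with d one of the 12 elements of <r_1, r_2>.  Acting on integral combinations
   of alpha_0, alpha_1, alpha_2, which are linearly independent over Z as
   rational functions, X and Y are independent translations along
   alpha_0 + 2 alpha_1 + 3 alpha_2 and d is determined by its linear part. *)
Require Import Defs.
From HB Require Import structures.
From mathcomp Require Import all_boot all_order all_algebra.
From mathcomp Require Import all_classical all_reals all_analysis.
From mathcomp Require Import complex.
From mathcomp Require mpoly.
Import (canonicals) mpoly.
From mathcomp Require Import zify ring.

Set Implicit Arguments.
Unset Strict Implicit.
Unset Printing Implicit Defensive.

Import Order.TTheory GRing.Theory Num.Theory.
Import numFieldNormedType.Exports.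

Local Open Scope classical_set_scope.
Local Open Scope ring_scope.

(** * Rational functions: induction, derivations, substitutions *)

Section RationalFunctions.
Variable C : numClosedFieldType.
Local Notation K := (ratfun C).
Local Notation P := (mpoly.mpoly 5 C).
Local Notation tf := (@FracField.tofrac P).

Lemma ratfun_repr (f : K) :
  let nd := frac (generic_quotient.repr f) in
  nd.2 != 0 /\ f = tf nd.1 / tf nd.2.
Proof.
set r := generic_quotient.repr f => /=.
have dr : (frac r).2 != 0 := denom_ratioP r.
split=> //; apply: (mulIf (x := tf (frac r).2)); first by rewrite tofrac_eq0.
rewrite divfK ?tofrac_eq0 // -{1}[f]generic_quotient.reprK -/r.
unlock FracField.tofrac.
rewrite -[LHS]FracField.pi_mul.
apply/generic_quotient.eqmodP/eqP; rewrite /= /FracField.mulf.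
by rewrite !numden_Ratio ?mulr1 ?oner_neq0 // mulrC.
Qed.

Lemma mpoly_ring_ind (Q : P -> Prop) :
  (forall c, Q (mpoly.mpolyC 5 c)) ->
  (forall i, Q (mpoly.mpolyX C (mpoly.mnm1 i))) ->
  (forall p q, Q p -> Q q -> Q (p + q)) ->
  (forall p q, Q p -> Q q -> Q (p * q)) -> forall p, Q p.
Proof.
move=> Qc Qx Qa Qm; elim/mpoly.mpolyind; first by rewrite -(mpoly.mpolyC0 5).
move=> c m p _ _ Qp; apply: Qa => //; rewrite -mpoly.mul_mpolyC.
apply: (Qm) => //; rewrite mpoly.mpolyXE_id.
have Q1 : Q 1 by rewrite -(mpoly.mpolyC1 5).
apply: (big_ind Q) => [//|p1 p2|i _]; first exact: Qm.
elim: (mpoly.fun_of_multinom m i) => [|k IH]; first by rewrite expr0.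
by rewrite exprS; apply: Qm.
Qed.

Lemma ratfun_ind (Q : K -> Prop) :
  (forall c, Q (ratcst c)) -> (forall i, Q (ratvar C i)) ->
  (forall f g, Q f -> Q g -> Q (f + g)) ->
  (forall f g, Q f -> Q g -> Q (f * g)) ->
  (forall f, Q f -> Q f^-1) -> forall f, Q f.
Proof.
move=> Qc Qx Qa Qm Qv f; have [_ ->] := ratfun_repr f.
have Qp p : Q (tf p).
  elim/mpoly_ring_ind: p => // p q Qp Qq; first by rewrite tofracD; apply: Qa.
  by rewrite tofracM; apply: Qm.
by apply: Qm => //; apply: Qv.
Qed.

End RationalFunctions.

(** * Derivations of the field of rational functions *)

Lemma quotient_rule_add (F : fieldType) (n d n' d' dn dd dn' dd' : F) :
  d != 0 -> d' != 0 ->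
  ((dn * d' + n * dd' + (dn' * d + n' * dd)) * (d * d') -
   (n * d' + n' * d) * (dd * d' + d * dd')) / (d * d') ^+ 2 =
  (dn * d - n * dd) / d ^+ 2 + (dn' * d' - n' * dd') / d' ^+ 2.
Proof. by move=> d0 d0'; field; rewrite d0 d0'. Qed.

Lemma quotient_rule_mul (F : fieldType) (n d n' d' dn dd dn' dd' : F) :
  d != 0 -> d' != 0 ->
  ((dn * n' + n * dn') * (d * d') - n * n' * (dd * d' + d * dd')) / (d * d') ^+ 2 =
  (dn * d - n * dd) / d ^+ 2 * (n' / d') + n / d * ((dn' * d' - n' * dd') / d' ^+ 2).
Proof. by move=> d0 d0'; field; rewrite d0 d0'. Qed.

Lemma leibniz_sum (F : fieldType) (da db ea eb fa fb u : F) :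
  da * fb + fa * db + u * (ea * fb + fa * eb) =
  (da + u * ea) * fb + fa * (db + u * eb).
Proof. by ring. Qed.

(** Here [x] is the derivative of an inverse [a^-1]: the second hypothesis is the Leibniz rule
    applied to [a^-1 * a = 1]. *)
Lemma leibniz_inv (F : fieldType) (x fa fi da : F) :
  fa != 0 -> x * fa + fi * da = 0 -> x = - (fi * da) / fa.
Proof. by move=> fa0 /eqP; rewrite addr_eq0 => /eqP <-; rewrite mulfK. Qed.

(** Independence of the quotient rule from the representing fraction: [dn], [dd] stand for the
    derivatives of [n], [d], and the last hypothesis is the derivative of the cross-multiplied
    equality before it. *)
Lemma quotient_rule_wd (F : fieldType) (n d n' d' dn dd dn' dd' : F) :
  d != 0 -> d' != 0 -> n * d' = n' * d ->
  dn * d' + n * dd' = dn' * d + n' * dd ->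
  (dn * d - n * dd) / d ^+ 2 = (dn' * d' - n' * dd') / d' ^+ 2.
Proof.
move=> d0 d0' e de.
have -> : n = n' * d / d' by rewrite -e mulfK.
have -> : dn = (dn' * d + n' * dd - n' * d / d' * dd') / d'.
  by rewrite -e mulfK // -de addrK mulfK.
by field; rewrite d0 d0'.
Qed.

Section Derivations.
Variable C : numClosedFieldType.
Local Notation K := (ratfun C).
Local Notation P := (mpoly.mpoly 5 C).
Local Notation tf := (@FracField.tofrac P).

Definition endo (f : K -> K) : Prop :=
  [/\ GRing.zmod_morphism f, GRing.monoid_morphism f &
      forall c : C, f (ratcst c) = ratcst c].

(** The Leibniz rule is twisted by [f] so that both sides of a chain rule are derivations along the
    same [f]; ordinary derivations are those along [id]. *)
Definition derivation_along (f d : K -> K) : Prop :=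
  [/\ forall a b, d (a + b) = d a + d b,
      forall a b, d (a * b) = d a * f b + f a * d b &
      forall c : C, d (ratcst c) = 0].

Lemma ratfun_frac (f : K) : exists n d : P, d != 0 /\ f = tf n / tf d.
Proof. by have [? ?] := ratfun_repr f; do 2!eexists; split; eassumption. Qed.

Lemma endo_rmorphism f : endo f -> exists F : {rmorphism K -> K}, F = f :> (K -> K).
Proof.
move=> [fa fm _].
pose fA := GRing.isZmodMorphism.Build K K f fa.
pose fM := GRing.isMonoidMorphism.Build K K f fm.
pose F : {rmorphism K -> K} := HB.pack f fA fM.
by exists F.
Qed.

Lemma endo_ext f g : endo f -> endo g ->
  (forall i, f (ratvar C i) = g (ratvar C i)) -> f = g.
Proof.
move=> hf hg e; apply/funext => z.
have [F Ff] := endo_rmorphism hf; have [G Gg] := endo_rmorphism hg.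
case: hf hg => _ _ fc [_ _ gc].
elim/ratfun_ind: z => [c|i|a b|a b|a]; rewrite ?fc ?gc // -Ff -Gg.
- by rewrite !rmorphD => -> ->.
- by rewrite !rmorphM => -> ->.
- by rewrite !fmorphV => ->.
Qed.

(** The variables generate the field over the constants, and the Leibniz rule on [a^-1 * a = 1]
    forces the value at [a^-1]. This uniqueness is the source of every chain rule below. *)
Lemma derivation_along_ext f d e : endo f ->
  derivation_along f d -> derivation_along f e ->
  (forall i, d (ratvar C i) = e (ratvar C i)) -> d = e.
Proof.
move=> hf [da dm dc] [ea em ec] de; apply/funext => z.
have [F Ff] := endo_rmorphism hf; case: hf => _ _ fc.
elim/ratfun_ind: z => [c|i|a b|a b|a IH]; rewrite ?dc ?ec //.
- by rewrite da ea => -> ->.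
- by rewrite dm em => -> ->.
(* The inverse of 0 is 0 by convention, and 0 is a constant, killed by both derivations. *)
have [->|a0] := eqVneq a 0.
  have z0 : 0 = ratcst (0 : C) by rewrite /ratcst mpoly.mpolyC0 tofrac0.
  by rewrite invr0 z0 dc ec.
have fa0 : f a != 0 by rewrite -Ff fmorph_eq0.
have one : 1 = ratcst (1 : C) by rewrite /ratcst mpoly.mpolyC1 tofrac1.
have := em a^-1 a; rewrite mulVf // {1}one ec => /esym/(leibniz_inv fa0) ->.
by have := dm a^-1 a; rewrite mulVf // {1}one dc -IH => /esym/(leibniz_inv fa0).
Qed.

Lemma pderivE i n d : d != 0 -> pderiv i (tf n / tf d : K) =
  tf (mpoly.mderiv i n * d - n * mpoly.mderiv i d) / tf d ^+ 2.
Proof.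
move=> d0; rewrite /pderiv.
have [] := ratfun_repr (tf n / tf d).
case: (frac _) => n' d' /= d0' e.
have e' : n * d' = n' * d.
  apply/eqP; rewrite -tofrac_eq !tofracM; apply/eqP.
  apply: (mulIf (x := (tf d)^-1)); first by rewrite invr_eq0 tofrac_eq0.
  rewrite mulfK ?tofrac_eq0 // mulrAC e divfK ?tofrac_eq0 //.
rewrite !tofracB !tofracM; apply: quotient_rule_wd; rewrite ?tofrac_eq0 //.
  by rewrite -!tofracM e'.
by rewrite -!tofracM -!tofracD -!mpoly.mderivM e'.
Qed.

Lemma pderiv_tofrac i p : pderiv i (tf p : K) = tf (mpoly.mderiv i p).
Proof.
rewrite -[tf p]divr1 -tofrac1 pderivE ?oner_neq0 // tofrac1 expr1n divr1.
by rewrite -(mpoly.mpolyC1 5 C) mpoly.mderivC mulr0 subr0 mpoly.mpolyC1 mulr1.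
Qed.

Lemma pderiv_derivation i : derivation_along id (@pderiv C i).
Proof.
split=> [a b|a b|c].
- have [n [d [d0 ->]]] := ratfun_frac a; have [n' [d' [d0' ->]]] := ratfun_frac b.
  have -> : tf n / tf d + tf n' / tf d' = tf (n * d' + n' * d) / tf (d * d').
    by rewrite tofracD !tofracM addf_div ?tofrac_eq0.
  rewrite !pderivE ?mulf_neq0 // !tofracB !tofracM !mpoly.mderivD !mpoly.mderivM.
  rewrite !tofracD !tofracM; apply: quotient_rule_add; by rewrite tofrac_eq0.
- have [n [d [d0 ->]]] := ratfun_frac a; have [n' [d' [d0' ->]]] := ratfun_frac b.
  have -> : tf n / tf d * (tf n' / tf d') = tf (n * n') / tf (d * d').
    by rewrite !tofracM mulf_div ?tofrac_eq0.
  rewrite !pderivE ?mulf_neq0 // !tofracB !tofracM !mpoly.mderivM.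
  rewrite !tofracD !tofracM; apply: quotient_rule_mul; by rewrite tofrac_eq0.
- by rewrite /ratcst pderiv_tofrac mpoly.mderivC tofrac0.
Qed.

Lemma pderiv_ratvar i j : pderiv i (ratvar C j) = (i == j)%:R.
Proof.
rewrite /ratvar pderiv_tofrac mpoly.mderivX mpoly.mnm1E eq_sym.
case: eqP => [->|_]; last by rewrite scale0r tofrac0.
rewrite scale1r -tofrac1; congr tf; rewrite -mpoly.mpolyX0; congr mpoly.mpolyX.
by apply/mpoly.mnmP => k; rewrite mpoly.mnmBE subnn mpoly.mnm0E.
Qed.

Lemma derivation_sum f (d e : K -> K) (u : K) :
  derivation_along f d -> derivation_along f e ->
  derivation_along f (fun z => d z + u * e z).
Proof.
move=> [da dm dc] [ea em ec]; split=> [a b|a b|c].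
- by rewrite da ea mulrDr addrACA.
- rewrite dm em; exact: leibniz_sum.
- by rewrite dc ec mulr0 addr0.
Qed.

Lemma ddt_derivation : derivation_along id (@ddt C).
Proof.
apply: derivation_sum; last exact: pderiv_derivation.
by apply: derivation_sum; apply: pderiv_derivation.
Qed.

End Derivations.
Lemma eq_frac (F : fieldType) (n d n' d' : F) : d != 0 -> d' != 0 ->
  n / d = n' / d' <-> n * d' = n' * d.
Proof.
by move=> d0 d0'; split=> [/eqP|e]; last apply/eqP; rewrite eqr_div // ?e // => /eqP.
Qed.

(** * Substitution of rational functions for the variables *)

Section Substitutions.
Variable C : numClosedFieldType.
Local Notation K := (ratfun C).
Local Notation P := (mpoly.mpoly 5 C).
Local Notation tf := (@FracField.tofrac P).

Definition subst (v : 'I_5 -> K) : P -> K := mpoly.mmap (tf \o @mpoly.mpolyC 5 C) v.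

Lemma substC v c : subst v (mpoly.mpolyC 5 c) = ratcst c.
Proof. exact: mpoly.mmapC. Qed.

Lemma substX v i : subst v (mpoly.mpolyX C (mpoly.mnm1 i)) = v i.
Proof. by rewrite /subst mpoly.mmapX mpoly.mmap1U. Qed.

Lemma substD v p q : subst v (p + q) = subst v p + subst v q.
Proof. exact: rmorphD. Qed.

Lemma substB v p q : subst v (p - q) = subst v p - subst v q.
Proof. exact: rmorphB. Qed.

Lemma substM v p q : subst v (p * q) = subst v p * subst v q.
Proof. exact: rmorphM. Qed.

Lemma subst1 v : subst v 1 = 1.
Proof. exact: rmorph1. Qed.

(* The partial extension of [subst v] to the fractions whose denominator is not
   killed. *)
Definition subst_rel v (z w : K) : Prop := exists n d : P,
  [/\ subst v d != 0, z = tf n / tf d & w = subst v n / subst v d].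

Lemma subst_denom v d : subst v d != 0 -> d != 0.
Proof.
apply: contraNneq => ->; have -> : (0 : P) = 1 - 1 by rewrite subrr.
by rewrite substB subrr.
Qed.

Lemma subst_rel_fun v z w w' : subst_rel v z w -> subst_rel v z w' -> w = w'.
Proof.
move=> [n [d [d0 -> ->]]] [n' [d' [d0' e ->]]].
have D : tf d != 0 by rewrite tofrac_eq0 (subst_denom d0).
have D' : tf d' != 0 by rewrite tofrac_eq0 (subst_denom d0').
apply/eq_frac => //; rewrite -!substM; congr (subst v _).
apply/eqP; rewrite -tofrac_eq !tofracM; apply/eqP.
exact: (eq_frac _ _ D D').1 e.
Qed.

Lemma subst_rel_tofrac v p : subst_rel v (tf p) (subst v p).
Proof. by exists p, 1; rewrite subst1 tofrac1 !divr1 oner_neq0. Qed.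

Lemma subst_rel_cst v c : subst_rel v (ratcst c) (ratcst c).
Proof. by rewrite -{2}(substC v c); apply: subst_rel_tofrac. Qed.

Lemma subst_rel_var v i : subst_rel v (ratvar C i) (v i).
Proof. by rewrite -(substX v i); apply: subst_rel_tofrac. Qed.

Lemma subst_relD v z w z' w' :
  subst_rel v z w -> subst_rel v z' w' -> subst_rel v (z + z') (w + w').
Proof.
move=> [n [d [d0 -> ->]]] [n' [d' [d0' -> ->]]].
have D : tf d != 0 by rewrite tofrac_eq0 (subst_denom d0).
have D' : tf d' != 0 by rewrite tofrac_eq0 (subst_denom d0').
exists (n * d' + n' * d), (d * d'); split.
- rewrite substM; exact: mulf_neq0 d0 d0'.
- by rewrite (addf_div _ _ D D') tofracD !tofracM.
- by rewrite (addf_div _ _ d0 d0') substD !substM.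
Qed.

Lemma subst_relM v z w z' w' :
  subst_rel v z w -> subst_rel v z' w' -> subst_rel v (z * z') (w * w').
Proof.
move=> [n [d [d0 -> ->]]] [n' [d' [d0' -> ->]]].
exists (n * n'), (d * d'); split.
- rewrite substM; exact: mulf_neq0 d0 d0'.
- by rewrite mulf_div !tofracM.
- by rewrite mulf_div !substM.
Qed.

Lemma subst_relV v z w : subst_rel v z w -> w != 0 -> subst_rel v z^-1 w^-1.
Proof.
move=> [n [d [d0 -> ->]]] w0; exists d, n.
rewrite !invf_div; split=> [|//|//].
by apply: contraNneq w0 => ->; rewrite mul0r.
Qed.

Lemma ratcst_nat k : ratcst (k%:R : C) = k%:R.
Proof. by rewrite /ratcst rmorph_nat rmorph_nat. Qed.

Lemma subst_rel_nat v k : subst_rel v k%:R k%:R.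
Proof. by rewrite -ratcst_nat; apply: subst_rel_cst. Qed.

Lemma subst_relN v z w : subst_rel v z w -> subst_rel v (- z) (- w).
Proof.
move=> h; rewrite -mulN1r -(mulN1r w); apply: subst_relM h.
have -> : -1 = ratcst (-1 : C) by rewrite /ratcst !rmorphN !rmorph1.
exact: subst_rel_cst.
Qed.

Lemma subst_relX v z w k : subst_rel v z w -> subst_rel v (z ^+ k) (w ^+ k).
Proof.
move=> h; elim: k => [|k IH]; last by rewrite !exprS; apply: subst_relM.
exact: subst_rel_nat 1.
Qed.

(* A substitution with a partial left inverse is injective, hence extends to
   all fractions. *)
Lemma subst_inj v v' : (forall i, subst_rel v' (v i) (ratvar C i)) ->
  forall p, subst v p = 0 -> p = 0.
Proof.
move=> h p p0; have : subst_rel v' (subst v p) (tf p).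
  elim/mpoly_ring_ind: p {p0} => [c|i|p q|p q].
  - by rewrite substC; apply: subst_rel_cst.
  - by rewrite substX.
  - by rewrite substD tofracD; apply: subst_relD.
  - by rewrite substM tofracM; apply: subst_relM.
have c0 : ratcst (0 : C) = 0 by rewrite /ratcst mpoly.mpolyC0 tofrac0.
rewrite p0 -c0 => /subst_rel_fun/(_ (subst_rel_cst _ _))/eqP.
by rewrite c0 tofrac_eq0 => /eqP.
Qed.

(** Computed on the chosen representative, hence meaningful only when its denominator survives. *)
Definition subst_ext v (z : K) : K :=
  let nd := frac (generic_quotient.repr z) in subst v nd.1 / subst v nd.2.

(** Injectivity keeps every denominator alive, so [subst_rel v] is the graph of a total function;
    its functionality and its closure under the field operations then give the morphism laws. *)
Lemma subst_extP v : (forall p, subst v p = 0 -> p = 0) ->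
  endo (subst_ext v) /\ forall i, subst_ext v (ratvar C i) = v i.
Proof.
move=> inj; have nz p : p != 0 -> subst v p != 0.
  by apply: contraNneq => /inj ->.
have R z : subst_rel v z (subst_ext v z).
  rewrite /subst_ext; have [/nz d0 e] := ratfun_repr z.
  by exists (frac (generic_quotient.repr z)).1, (frac (generic_quotient.repr z)).2.
split; first split.
- by move=> a b; apply: subst_rel_fun (R _) _; apply: subst_relD => //; apply: subst_relN.
- split.
    exact: subst_rel_fun (R _) (subst_rel_nat _ 1%N).
  by move=> a b; apply: subst_rel_fun (R _) _; apply: subst_relM.
- by move=> c; apply: subst_rel_fun (R _) (subst_rel_cst _ _).
- by move=> i; apply: subst_rel_fun (R _) (subst_rel_var _ _).
Qed.

End Substitutions.

(** * The transformations on phase values *)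

(* The tangent map of [bt I k] at [v] applied to (dx, dy, dt), the parameters
   being fixed. *)
Definition bt_tangent (F : fieldType) (I : F) (k : node) (v : phase F)
    (dx dy dt : F) : F * F * F :=
  let: Phase x y t a0 a1 a2 := v in
  match k with
  | n0 => (dx, dy, dt)
  | n1 => (dx - a1 * dy / y ^+ 2, dy, dt)
  | n2 => (I * dx,
           - I * (dy + 3 * a2 * dx / x ^+ 2 + dt / x ^+ 2 - 2 * t * dx / x ^+ 3
                  - 3 * dx / (2 * x ^+ 4)),
           - I * dt)
  end.

Lemma sqrtN1_neq0 (F : fieldType) (I : F) : I ^+ 2 = -1 -> I != 0.
Proof.
move=> hI; apply: contra_eqN hI => /eqP ->.
by rewrite expr0n eq_sym oppr_eq0 oner_eq0.
Qed.

(** The push-forward of the vector field (dx/dt, dy/dt, 1) is proportional to the vector field of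
    the transformed system, with factor dT. This one computation serves both rational functions and
    actual solutions. *)
Lemma bt_system (F : fieldType) (I : F) (k : node) (v : phase F) :
  (2 : F) != 0 -> I ^+ 2 = -1 -> pa0 v + 2 * pa1 v + 3 * pa2 v = 1 ->
  bt_dom k v ->
  let: (dX, dY, dT) := bt_tangent I k v (dxdt v) (dydt v) 1 in
  dX = dxdt (bt I k v) * dT /\ dY = dydt (bt I k v) * dT.
Proof.
case: v => x y t a0 a1 a2 /= h2 hI ha.
(* Solving the constraint for [a0] turns the [n2] case into an identity in free variables modulo
   [I ^+ 2 = -1]. *)
have e : a0 = (a0 + 2 * a1 + 3 * a2) - 2 * a1 - 3 * a2 by ring.
rewrite ha in e; case: k => /= h.
- by split; ring.
- by split; field.
- have I0 := sqrtN1_neq0 hI.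
  by rewrite e; split; field: hI; rewrite ?h ?h2.
Qed.

Lemma eq_phase (F : Type) (x y t a0 a1 a2 x' y' t' a0' a1' a2' : F) :
  x = x' -> y = y' -> t = t' -> a0 = a0' -> a1 = a1' -> a2 = a2' ->
  Phase x y t a0 a1 a2 = Phase x' y' t' a0' a1' a2'.
Proof. by move=> -> -> -> -> -> ->. Qed.

(** * The braid relation of length six *)

Section Braid.
Variables (F : fieldType) (I x y t a0 a1 a2 : F).
Hypothesis h2 : (2 : F) != 0.
Hypothesis hI : I ^+ 2 = -1.

Let I0 : I != 0 := sqrtN1_neq0 hI.

(* Up to constants, the numerators and denominators of the x and y components
   along both sides of the braid relation are products of x, y and the
   polynomials f, g, h, p, q, e, m, n. *)
Let b := 2 * a1 + 3 * a2.
Let c := a1 + 3 * a2.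
Let f := x * y + a1.
Let h := 2 * x * f ^+ 2 + 2 * t * f + y.
Let g := 2 * f ^+ 3 - 6 * (a1 + a2) * f ^+ 2 + 2 * t * y * f + y ^+ 2.
Let p := 2 * f * x ^+ 2 + 2 * t * x + 1.
Let q := 2 * x ^+ 3 * y - 6 * a2 * x ^+ 2 + 2 * t * x + 1.
Let e := x * h + b.
Let m := - h ^+ 2 + 2 * b * h * (2 * x * f + t) + 2 * b ^+ 2 * f.
Let n := - y * p ^+ 2 + 2 * c * p * (2 * x * f + t) + 2 * c ^+ 2 * x.

(** These identities factor the numerators that arise: [gE] and [mE] serve the [n1] steps [A3] and
    [A5], [qE] and [nE] the [n1] steps [B2] and [B4], [idh] and [idp] the last [n2] steps [A6] and
    [B5], and [idhn] makes the two final [x] components meet in [B6]. *)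
Let gE : g = y * h - 2 * b * f ^+ 2. Proof. by rewrite /g /h /b /f; ring. Qed.
Let qE : q = p - 2 * c * x ^+ 2. Proof. by rewrite /q /p /c /f; ring. Qed.
Let eE : e = f * p + c. Proof. by rewrite /e /h /p /b /c /f; ring. Qed.
Let mE : c * h ^+ 2 - g * e = f * m. Proof. rewrite /m /e /g /h /c /b /f; ring. Qed.
Let nE : b * p ^+ 2 - q * e = x * n. Proof. rewrite eE /n /q /p /c /b /f; ring. Qed.
Let idp : 2 * q * e ^+ 3 - 6 * (a1 + a2) * p ^+ 2 * e ^+ 2 - 2 * t * p * e * n +
  n ^+ 2 = - p ^+ 3 * m.
Proof. rewrite /m /n /e /q /h /p /c /b /f; ring. Qed.
Let idh : 2 * g * e ^+ 3 - 6 * a2 * h ^+ 2 * e ^+ 2 - 2 * t * h * e * m + m ^+ 2 =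
  - h ^+ 3 * n.
Proof. rewrite /m /n /e /g /h /p /c /b /f; ring. Qed.
Let idhn : h * n = p * m - 2 * a1 * e ^+ 2.
Proof. rewrite /m /n /e /h /p /c /b /f; ring. Qed.

(** [A1] to [A6] follow the orbit that starts with [n1], [B1] to [B6] the one that starts with [n2].
    Along both, the parameter alpha_1 only takes the values [a1], [b], [c] up to sign, and each
    point is kept in factored form. *)
Let A1 : y != 0 ->
  bt I n1 (Phase x y t a0 a1 a2) = Phase (f / y) y t (a0 + a1) (- a1) (a2 + a1).
Proof. by move=> y0; apply: eq_phase => //; rewrite /f; field. Qed.

Let A2 : y != 0 -> f != 0 ->
  bt I n2 (Phase (f / y) y t (a0 + a1) (- a1) (a2 + a1)) =
  Phase (I * f / y) (- I * y * g / (2 * f ^+ 3)) (- I * t) (a0 + a1) b (- (a2 + a1)).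
Proof.
move=> y0 f0; apply: eq_phase; rewrite // /b /g; try ring.
by field; rewrite ?y0 ?h2 ?f0.
Qed.

Let A3 : y != 0 -> f != 0 -> g != 0 ->
  bt I n1 (Phase (I * f / y) (- I * y * g / (2 * f ^+ 3)) (- I * t) (a0 + a1) b (- (a2 + a1))) =
  Phase (I * f * h / g) (- I * y * g / (2 * f ^+ 3)) (- I * t) (a0 + a1 + b) (- b)
    (a1 + 2 * a2).
Proof.
move=> y0 f0 g0; apply: eq_phase => //; last by rewrite /b; ring.
have yh : y * h = g + 2 * b * f ^+ 2 by rewrite gE; ring.
by field: hI yh; rewrite ?g0 ?y0 ?f0 ?h2 ?oppr_eq0 ?I0.
Qed.

Let A4 : y != 0 -> f != 0 -> g != 0 -> h != 0 ->
  bt I n2 (Phase (I * f * h / g) (- I * y * g / (2 * f ^+ 3)) (- I * t) (a0 + a1 + b) (- b)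
    (a1 + 2 * a2)) =
  Phase (- f * h / g) (g * m / h ^+ 3) (- t) (a0 + a1 + b) c (- (a1 + 2 * a2)).
Proof.
move=> y0 f0 g0 h0; apply: eq_phase => //.
- by field: hI.
(* Up to the factor [g], the right-hand side is the numerator of the new [y] over
   [2 * f ^+ 3 * h ^+ 3]; its divisibility by [2 * f ^+ 3] is where [m] comes from. *)
- have k : 2 * f ^+ 3 * m =
      - y * h ^+ 3 + 6 * (a1 + 2 * a2) * f ^+ 2 * h ^+ 2 + 2 * t * f * g * h + g ^+ 2.
    by rewrite /m /g /h /b /f; ring.
  have -> : g * m / h ^+ 3 = g * (2 * f ^+ 3 * m) / (2 * f ^+ 3 * h ^+ 3).
    by field; rewrite ?h0 ?f0 ?h2.
  by rewrite k; field: hI; rewrite ?h0 ?g0 ?f0 ?h2 ?oppr_eq0 ?I0.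
- by ring: hI.
- by rewrite /b /c; ring.
Qed.

Let A5 : f != 0 -> g != 0 -> h != 0 -> m != 0 ->
  bt I n1 (Phase (- f * h / g) (g * m / h ^+ 3) (- t) (a0 + a1 + b) c (- (a1 + 2 * a2))) =
  Phase (h * e / m) (g * m / h ^+ 3) (- t) (a0 + a1 + b + c) (- c) a2.
Proof.
move=> f0 g0 h0 m0; apply: eq_phase => //; last by rewrite /c; ring.
have k : g * e = c * h ^+ 2 - f * m by rewrite -mE; ring.
have -> : h * e / m = h * (g * e) / (g * m) by field; rewrite ?m0 ?g0.
by rewrite k; field; rewrite ?m0 ?h0 ?g0.
Qed.

Let A6 : h != 0 -> m != 0 -> e != 0 ->
  bt I n2 (Phase (h * e / m) (g * m / h ^+ 3) (- t) (a0 + a1 + b + c) (- c) a2) =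
  Phase (I * (h * e / m)) (I * n * m / (2 * e ^+ 3)) (I * t) (a0 + a1 + b + c) (- a1) (- a2).
Proof.
move=> h0 m0 e0; apply: eq_phase => //; try by rewrite /c; ring.
have -> : I * n * m / (2 * e ^+ 3) = - I * m * (- h ^+ 3 * n) / (2 * h ^+ 3 * e ^+ 3).
  by field; rewrite ?e0 ?h0 ?h2.
by rewrite -idh; field; rewrite ?m0 ?e0 ?h0 ?h2.
Qed.

Let B1 : x != 0 -> bt I n2 (Phase x y t a0 a1 a2) =
  Phase (I * x) (- I * q / (2 * x ^+ 3)) (- I * t) a0 c (- a2).
Proof. by move=> x0; apply: eq_phase => //; rewrite /q; field; rewrite ?x0 ?h2. Qed.

Let B2 : x != 0 -> q != 0 ->
  bt I n1 (Phase (I * x) (- I * q / (2 * x ^+ 3)) (- I * t) a0 c (- a2)) =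
  Phase (I * x * p / q) (- I * q / (2 * x ^+ 3)) (- I * t) (a0 + c) (- c) (a1 + 2 * a2).
Proof.
move=> x0 q0; apply: eq_phase => //; last by rewrite /c; ring.
have -> : p = q + 2 * c * x ^+ 2 by rewrite qE; ring.
by field: hI; rewrite ?q0 ?x0 ?h2 ?oppr_eq0 ?I0.
Qed.

Let B3 : x != 0 -> q != 0 -> p != 0 ->
  bt I n2 (Phase (I * x * p / q) (- I * q / (2 * x ^+ 3)) (- I * t) (a0 + c) (- c) (a1 + 2 * a2)) =
  Phase (- x * p / q) (q * n / p ^+ 3) (- t) (a0 + c) b (- (a1 + 2 * a2)).
Proof.
move=> x0 q0 p0; apply: eq_phase => //.
- by field: hI.
(* As in [A4]: [n] is the quotient by [2 * x ^+ 3] of the numerator of the new [y], up to the factor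
   [q]. *)
- have k : 2 * x ^+ 3 * n =
      - p ^+ 3 + 6 * (a1 + 2 * a2) * x ^+ 2 * p ^+ 2 + 2 * t * x * q * p + q ^+ 2.
    by rewrite /n /q /p /c /f; ring.
  have -> : q * n / p ^+ 3 = q * (2 * x ^+ 3 * n) / (2 * x ^+ 3 * p ^+ 3).
    by field; rewrite ?p0 ?x0 ?h2.
  by rewrite k; field: hI; rewrite ?p0 ?q0 ?x0 ?h2 ?oppr_eq0 ?I0.
- by ring: hI.
- by rewrite /b /c; ring.
Qed.

Let B4 : x != 0 -> q != 0 -> p != 0 -> n != 0 ->
  bt I n1 (Phase (- x * p / q) (q * n / p ^+ 3) (- t) (a0 + c) b (- (a1 + 2 * a2))) =
  Phase (p * e / n) (q * n / p ^+ 3) (- t) (a0 + c + b) (- b) (a1 + a2).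
Proof.
move=> x0 q0 p0 n_0; apply: eq_phase => //; last by rewrite /b; ring.
have k : q * e = b * p ^+ 2 - x * n by rewrite -nE; ring.
have -> : p * e / n = p * (q * e) / (q * n) by field; rewrite ?n_0 ?q0.
by rewrite k; field; rewrite ?n_0 ?p0 ?q0.
Qed.

Let B5 : p != 0 -> n != 0 -> e != 0 ->
  bt I n2 (Phase (p * e / n) (q * n / p ^+ 3) (- t) (a0 + c + b) (- b) (a1 + a2)) =
  Phase (I * (p * e / n)) (I * n * m / (2 * e ^+ 3)) (I * t) (a0 + c + b) a1 (- (a1 + a2)).
Proof.
move=> p0 n_0 e0; apply: eq_phase => //; try by rewrite ?/b; ring.
have -> : I * n * m / (2 * e ^+ 3) = - I * n * (- p ^+ 3 * m) / (2 * p ^+ 3 * e ^+ 3).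
  by field; rewrite ?e0 ?p0 ?h2.
by rewrite -idp; field; rewrite ?n_0 ?e0 ?p0 ?h2.
Qed.

Let B6 : n != 0 -> m != 0 -> e != 0 ->
  bt I n1 (Phase (I * (p * e / n)) (I * n * m / (2 * e ^+ 3)) (I * t)
    (a0 + c + b) a1 (- (a1 + a2))) =
  Phase (I * (h * e / m)) (I * n * m / (2 * e ^+ 3)) (I * t) (a0 + a1 + b + c) (- a1) (- a2).
Proof.
move=> n_0 m0 e0; apply: eq_phase => //; try by ring.
have -> : h * e / m = h * n * e / (n * m) by field; rewrite ?m0 ?n_0.
by rewrite idhn; field: hI; rewrite ?m0 ?n_0 ?e0 ?h2 ?oppr_eq0 ?I0.
Qed.

(** Regularity of the whole orbit stands in for a list of nonvanishing conditions: each point, once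
    computed, displays as a factor of its numerator the polynomial by which a later step divides.
    [foldr] applies the last letter first. *)
Lemma bt_braid12 (v := Phase x y t a0 a1 a2) :
  (forall w, px (foldr (bt I) v w) != 0 /\ py (foldr (bt I) v w) != 0) ->
  foldr (bt I) v [:: n2; n1; n2; n1; n2; n1] =
  foldr (bt I) v [:: n1; n2; n1; n2; n1; n2].
Proof.
move=> reg; have nzr u w : u * w != 0 -> w != 0 :> F.
  by apply: contraNneq => ->; rewrite mulr0.
have nzl u w : u / w != 0 -> u != 0 :> F.
  by apply: contraNneq => ->; rewrite mul0r.
have [x0 y0] : x != 0 /\ y != 0 := reg [::].
have E1 : foldr (bt I) v [:: n1] = _ := A1 y0.
have f0 : f != 0 by have [] := reg [:: n1]; rewrite E1 => /nzl.
have E2 : foldr (bt I) v [:: n2; n1] = _ := etrans (congr1 (bt I n2) E1) (A2 y0 f0).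
have g0 : g != 0 by have [_] := reg [:: n2; n1]; rewrite E2 => /nzl/nzr.
have E3 : foldr (bt I) v [:: n1; n2; n1] = _ :=
  etrans (congr1 (bt I n1) E2) (A3 y0 f0 g0).
have h0 : h != 0 by have [] := reg [:: n1; n2; n1]; rewrite E3 => /nzl/nzr.
have E4 : foldr (bt I) v [:: n2; n1; n2; n1] = _ :=
  etrans (congr1 (bt I n2) E3) (A4 y0 f0 g0 h0).
have m0 : m != 0 by have [_] := reg [:: n2; n1; n2; n1]; rewrite E4 => /nzl/nzr.
have E5 : foldr (bt I) v [:: n1; n2; n1; n2; n1] = _ :=
  etrans (congr1 (bt I n1) E4) (A5 f0 g0 h0 m0).
have e0 : e != 0.
  by have [] := reg [:: n1; n2; n1; n2; n1]; rewrite E5 => /nzl/nzr.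
have E6 : foldr (bt I) v [:: n2; n1; n2; n1; n2; n1] = _ :=
  etrans (congr1 (bt I n2) E5) (A6 h0 m0 e0).
have D1 : foldr (bt I) v [:: n2] = _ := B1 x0.
have q0 : q != 0 by have [_] := reg [:: n2]; rewrite D1 => /nzl/nzr.
have D2 : foldr (bt I) v [:: n1; n2] = _ := etrans (congr1 (bt I n1) D1) (B2 x0 q0).
have p0 : p != 0 by have [] := reg [:: n1; n2]; rewrite D2 => /nzl/nzr.
have D3 : foldr (bt I) v [:: n2; n1; n2] = _ :=
  etrans (congr1 (bt I n2) D2) (B3 x0 q0 p0).
have n_0 : n != 0 by have [_] := reg [:: n2; n1; n2]; rewrite D3 => /nzl/nzr.
have D4 : foldr (bt I) v [:: n1; n2; n1; n2] = _ :=
  etrans (congr1 (bt I n1) D3) (B4 x0 q0 p0 n_0).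
have D5 : foldr (bt I) v [:: n2; n1; n2; n1; n2] = _ :=
  etrans (congr1 (bt I n2) D4) (B5 p0 n_0 e0).
have D6 : foldr (bt I) v [:: n1; n2; n1; n2; n1; n2] = _ :=
  etrans (congr1 (bt I n1) D5) (B6 n_0 m0 e0).
by rewrite E6 D6.
Qed.

End Braid.

(** * The remaining relations, and compatibility with field morphisms *)

Section BtAlgebra.
Variables (F : fieldType) (I : F).
Hypothesis h2 : (2 : F) != 0.
Hypothesis hI : I ^+ 2 = -1.

Definition constrained (v : phase F) : Prop := pa0 v + 2 * pa1 v + 3 * pa2 v = 1.

Lemma bt_constrained k v : constrained v -> constrained (bt I k v).
Proof. by case: v k => x y t a0 a1 a2 []; rewrite /constrained /= => h; rewrite -[RHS]h; ring. Qed.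

Lemma bt0K v : bt I n0 (bt I n0 v) = v.
Proof. by case: v => *; apply: eq_phase => //; ring. Qed.

Lemma bt1K v : py v != 0 -> bt I n1 (bt I n1 v) = v.
Proof. by case: v => x y t a0 a1 a2 /= y0; apply: eq_phase => //; try ring; field. Qed.

Lemma bt22 v : px v != 0 ->
  let: Phase x y t a0 a1 a2 := v in
  bt I n2 (bt I n2 v) = Phase (- x) (- y) (- t) a0 a1 a2.
Proof.
have I0 := sqrtN1_neq0 hI.
case: v => x y t a0 a1 a2 /= x0; apply: eq_phase => //; try by ring: hI.
by field: hI; rewrite ?x0 ?h2 ?oppr_eq0 ?I0.
Qed.

(** The exponent 4 covers all nodes at once: two involutions, and [n2], whose square is a sign
    change. It makes [iter 3 (bt I k)] an inverse. *)
Lemma bt_pow4 k v : px v != 0 -> py v != 0 -> iter 4 (bt I k) v = v.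
Proof.
move=> x0 y0; case: k => /=; first by rewrite !bt0K.
  by rewrite (@bt1K (bt I n1 (bt I n1 v))) bt1K.
case: v x0 y0 => x y t a0 a1 a2 x0 y0.
have e := @bt22 (Phase x y t a0 a1 a2) x0.
have x0' : px (Phase (- x) (- y) (- t) a0 a1 a2) != 0 by rewrite oppr_eq0.
by have := bt22 x0'; rewrite -e !opprK.
Qed.

Lemma bt_braid01 v : py v != 0 ->
  bt I n0 (bt I n1 (bt I n0 v)) = bt I n1 (bt I n0 (bt I n1 v)).
Proof. by case: v => x y t a0 a1 a2 /= y0; apply: eq_phase => //; try ring; field. Qed.

Lemma bt_comm02 v : px v != 0 -> bt I n0 (bt I n2 v) = bt I n2 (bt I n0 v).
Proof. by case: v => x y t a0 a1 a2 /= y0; apply: eq_phase => //; ring. Qed.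

End BtAlgebra.

Section BtMorphism.
Variables (F F' : fieldType) (G : {rmorphism F -> F'}).

Lemma dxdt_rmorph v : G (dxdt v) = dxdt (map_phase G v).
Proof. by case: v => *; rewrite /= !(rmorph_nat, rmorphD, rmorphM, rmorphXn, rmorph1). Qed.

Lemma dydt_rmorph v : G (dydt v) = dydt (map_phase G v).
Proof.
by case: v => *; rewrite /= !(rmorph_nat, rmorphB, rmorphD, rmorphN, rmorphM, rmorphXn).
Qed.

Lemma bt_rmorph I k v : map_phase G (bt I k v) = bt (G I) k (map_phase G v).
Proof.
case: v k => x y t a0 a1 a2 []; apply: eq_phase;
by rewrite ?(rmorph_nat, rmorphB, rmorphD, rmorphN, rmorphM, rmorphXn, fmorphV, rmorph1).
Qed.

Lemma map_phase_constrained v : constrained v -> constrained (map_phase G v).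
Proof.
by rewrite /constrained => /(congr1 G); rewrite !(rmorph_nat, rmorphD, rmorphM) rmorph1.
Qed.

End BtMorphism.

(** * The transformations as automorphisms *)

Section EndoExistence.
Variable C : numClosedFieldType.
Local Notation K := (ratfun C).
Local Notation P := (mpoly.mpoly 5 C).
Local Notation J := (ratcst ('i : C)).

Lemma ord5_ind (Q : 'I_5 -> Prop) :
  Q xi -> Q yi -> Q ti -> Q a1i -> Q a2i -> forall i, Q i.
Proof.
move=> q0 q1 q2 q3 q4 [[|[|[|[|[|//]]]]] lt_i]; by rewrite (bool_irrelevance lt_i isT).
Qed.

(** The order is that of [ratvar]; alpha_0 is left out because the constraint determines it. *)
Definition phase_val (v : phase K) (i : 'I_5) : K :=
  nth 0 [:: px v; py v; pt v; pa1 v; pa2 v] i.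

Lemma ratfun_two : (2 : K) != 0.
Proof. by rewrite -ratcst_nat /ratcst tofrac_eq0 mpoly.mpolyC_eq0 pnatr_eq0. Qed.

Lemma ratcst_i : J ^+ 2 = -1.
Proof. by rewrite /ratcst -!rmorphXn sqrCi !rmorphN !rmorph1. Qed.

Lemma coords_constrained : constrained (coords C).
Proof. by rewrite /constrained /= addrAC subrK subrK. Qed.

Lemma ratvar_neq0 i : ratvar C i != 0.
Proof.
rewrite /ratvar tofrac_eq0 -mpoly.msize_poly_eq0 mpoly.msizeX.
by [].
Qed.

Lemma endo_inj f : endo f -> forall z : K, z != 0 -> f z != 0.
Proof. by move=> /endo_rmorphism[F <-] z; rewrite fmorph_eq0. Qed.

Lemma endo_comp f g : endo f -> endo g -> endo (f \o g : K -> K).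
Proof.
move=> [fa [fm1 fm] fc] [ga [gm1 gm] gc]; split.
- by move=> a b /=; rewrite ga fa.
- by split=> [|a b] /=; rewrite ?gm1 ?fm1 // gm fm.
- by move=> c /=; rewrite gc fc.
Qed.

Lemma endo_id : endo (id : K -> K).
Proof. by split. Qed.

Lemma endo_coords_ext (f g : K -> K) : endo f -> endo g ->
  map_phase f (coords C) = map_phase g (coords C) -> f = g.
Proof. by move=> hf hg [] *; apply: endo_ext => //; apply: ord5_ind. Qed.

Lemma endo_bt f k v : endo f ->
  map_phase f (bt J k v) = bt J k (map_phase f v).
Proof.
move=> hf; have [F Ff] := endo_rmorphism hf; case: hf => _ _ fc.
by rewrite -Ff bt_rmorph Ff fc.
Qed.

End EndoExistence.

Lemma constrained_pa0 (F : fieldType) (u : phase F) : constrained u ->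
  pa0 u = 1 - 2 * pa1 u - 3 * pa2 u.
Proof. by rewrite /constrained => h; rewrite -[X in X - _ - _]h; ring. Qed.

Section Existence.
Variable C : numClosedFieldType.
Local Notation K := (ratfun C).
Local Notation J := (ratcst ('i : C)).

Definition phase_rel (u : phase K) (v w : phase K) : Prop :=
  let r := subst_rel (phase_val u) in
  [/\ r (px v) (px w), r (py v) (py w) & r (pt v) (pt w)] /\
  [/\ r (pa0 v) (pa0 w), r (pa1 v) (pa1 w) & r (pa2 v) (pa2 w)].

Lemma bt_phase_rel u k v w : phase_rel u v w -> bt_dom k w ->
  phase_rel u (bt J k v) (bt J k w).
Proof.
case: v w => x y t a0 a1 a2 [x' y' t' a0' a1' a2'] [[/= hx hy ht] [/= h0 h1 h2]].
have D := @subst_relD C (phase_val u); have M := @subst_relM C (phase_val u).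
have N := @subst_relN C (phase_val u); have V := @subst_relV C (phase_val u).
have Z n := @subst_rel_nat C (phase_val u) n.
have X z z' n := @subst_relX C (phase_val u) z z' n.
have Cst := @subst_rel_cst C (phase_val u).
case: k => nz; split; split=> /=.
- exact: hx.
- exact: hy.
- exact: ht.
- exact: N.
- exact: D.
- exact: h2.
- exact: D hx (M _ _ _ _ h1 (V _ _ hy nz)).
- exact: hy.
- exact: ht.
- exact: D.
- exact: N.
- exact: D.
- exact: M.
- have x0 n : x' ^+ n != 0 by rewrite expf_neq0.
  have x2 : 2 * x' ^+ 3 != 0 by exact: mulf_neq0 (ratfun_two C) (x0 3%N).
  apply: (M _ _ _ _ (N _ _ (Cst _))); apply: (D); [apply: (D); [apply: (D _ _ _ _ hy)|]|].
  + exact: N (M _ _ _ _ (M _ _ _ _ (Z 3%N) h2) (V _ _ hx nz)).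
  + exact: M ht (V _ _ (X _ _ _ hx) (x0 2%N)).
  + exact: M (Z 1%N) (V _ _ (M _ _ _ _ (Z 2%N) (X _ _ _ hx)) x2).
- exact: M (N _ _ (Cst _)) ht.
- exact: h0.
- exact: D h1 (M _ _ _ _ (Z 3%N) h2).
- exact: N.
Qed.

Lemma coords_phase_rel u : constrained u -> phase_rel u (coords C) u.
Proof.
move=> hu; split; split; do ?exact: subst_rel_var.
have -> : pa0 u = 1 - 2 * pa1 u - 3 * pa2 u by apply: constrained_pa0.
apply: subst_relD; last apply: subst_relN.
  apply: subst_relD; first exact: subst_rel_nat 1%N.
  apply: subst_relN; apply: subst_relM; last exact: subst_rel_var.
  exact: subst_rel_nat.
by apply: subst_relM; [exact: subst_rel_nat|exact: subst_rel_var].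
Qed.

End Existence.

Section Generators.
Variable C : numClosedFieldType.
Local Notation K := (ratfun C).
Local Notation J := (ratcst ('i : C)).
Local Notation co := (coords C).

Lemma px_coords_neq0 : px co != 0. Proof. exact: ratvar_neq0. Qed.
Lemma py_coords_neq0 : py co != 0. Proof. exact: ratvar_neq0. Qed.

Lemma ratcst_i_neq0 : J != 0. Proof. exact: sqrtN1_neq0 (ratcst_i C). Qed.

(** Substituting [u], the third iterate, into [bt J k co] gives the fourth iterate, which is [co].
    The substitution by [bt J k co] thus has a partial left inverse, is injective on polynomials and
    extends to fractions. *)
Lemma endo_bt_exists k : exists f : K -> K, endo f /\ map_phase f co = bt J k co.
Proof.
pose u := iter 3 (bt J k) co.
have hu : constrained u by do 3!apply: bt_constrained; exact: coords_constrained.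
(* The denominators survive at [u]: for [n1] the iterates keep [y], and for [n2] the third one has
   first component [J * (J * (J * x))]. *)
have nz : bt_dom k u.
  case: k @u {hu} => //=; first exact: py_coords_neq0.
  have J0 := ratcst_i_neq0.
  exact: mulf_neq0 J0 (mulf_neq0 J0 (mulf_neq0 J0 px_coords_neq0)).
have := bt_phase_rel (coords_phase_rel hu) nz.
have -> : bt J k u = co.
  exact: bt_pow4 (ratfun_two C) (ratcst_i C) k _ px_coords_neq0 py_coords_neq0.
move=> [[hx hy ht] [_ h1 h2]].
have [|f_endo fE] := @subst_extP C (phase_val (bt J k co)).
  by apply: (@subst_inj _ _ (phase_val u)); apply: ord5_ind.
set f := subst_ext _ in f_endo fE; exists f; split; first by [].
have [F Ff] := endo_rmorphism f_endo.
(* The substitution prescribes five components; the sixth, alpha_0, follows from the constraint on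
   both sides. *)
have h : constrained (map_phase f co).
  by rewrite -Ff; apply: map_phase_constrained; exact: coords_constrained.
have h' : constrained (bt J k co) by apply: bt_constrained; exact: coords_constrained.
have e1 : pa1 (map_phase f co) = pa1 (bt J k co) := fE a1i.
have e2 : pa2 (map_phase f co) = pa2 (bt J k co) := fE a2i.
have e0 : pa0 (map_phase f co) = pa0 (bt J k co).
  by rewrite (constrained_pa0 h) (constrained_pa0 h') e1 e2.
have ex : px (map_phase f co) = px (bt J k co) := fE xi.
have ey : py (map_phase f co) = py (bt J k co) := fE yi.
have et : pt (map_phase f co) = pt (bt J k co) := fE ti.
case: (map_phase f co) (bt J k co) ex ey et e0 e1 e2 => ? ? ? ? ? ? [? ? ? ? ? ?].
exact: eq_phase.
Qed.

End Generators.

(** * Derivatives of the transformed coordinates *)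

Section LeibnizRules.
Variables (F : fieldType) (D : F -> F).
Hypothesis DD : forall a b, D (a + b) = D a + D b.
Hypothesis DM : forall a b, D (a * b) = D a * b + a * D b.

Lemma leibniz0 : D 0 = 0.
Proof. by apply: (addrI (D 0)); rewrite -DD !addr0. Qed.

Lemma leibniz1 : D 1 = 0.
Proof. by apply: (addrI (D 1)); rewrite addr0 -{3}[1]mulr1 DM mulr1 mul1r. Qed.

Lemma leibnizN a : D (- a) = - D a.
Proof. by apply/eqP; rewrite -addr_eq0 -DD addNr leibniz0. Qed.

Lemma leibniz_nat n : D n%:R = 0.
Proof. by elim: n => [|n IH]; rewrite ?leibniz0 // mulrS DD leibniz1 IH addr0. Qed.

Lemma leibnizV a : a != 0 -> D a^-1 = - D a / a ^+ 2.
Proof.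
move=> a0; have := DM a^-1 a; rewrite mulVf // leibniz1 => /esym/(leibniz_inv a0) ->.
by field.
Qed.

Lemma leibniz2 a : D (a ^+ 2) = 2 * a * D a.
Proof. by rewrite expr2 DM; ring. Qed.

Lemma leibniz3 a : D (a ^+ 3) = 3 * a ^+ 2 * D a.
Proof. by rewrite exprS DM leibniz2; ring. Qed.

Lemma bt_derivation I k v : (2 : F) != 0 -> D I = 0 ->
  D (pa1 v) = 0 -> D (pa2 v) = 0 -> bt_dom k v ->
  let w := bt I k v in
  (D (px w), D (py w), D (pt w)) =
  bt_tangent I k v (D (px v)) (D (py v)) (D (pt v)).
Proof.
case: v => x y t a0 a1 a2 /= h2 hI ha1 ha2; case: k => /= h.
- by [].
- congr (_, _, _); rewrite DD DM ha1 leibnizV //; by field.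
- have x3 : 2 * x ^+ 3 != 0 by rewrite mulf_neq0 ?expf_neq0.
  congr (_, _, _); first by rewrite DM hI; ring.
    have D3 : D (3 * a2 / x) = - (3 * a2 * D x / x ^+ 2).
      by rewrite DM DM ha2 leibniz_nat (leibnizV h); field.
    have Dt : D (t / x ^+ 2) = D t / x ^+ 2 - 2 * t * D x / x ^+ 3.
      by rewrite DM leibnizV ?expf_neq0 // leibniz2; field.
    have D1 : D (1 / (2 * x ^+ 3)) = - (3 * D x / (2 * x ^+ 4)).
      rewrite DM leibniz1 (leibnizV x3) DM leibniz_nat leibniz3.
      by field; rewrite h h2.
    rewrite DM leibnizN hI !DD leibnizN D3 Dt D1; ring.
  by rewrite DM leibnizN hI; ring.
Qed.

Lemma bt_derivation_params I k v :
  D (pa0 v) = 0 -> D (pa1 v) = 0 -> D (pa2 v) = 0 ->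
  let w := bt I k v in [/\ D (pa0 w) = 0, D (pa1 w) = 0 & D (pa2 w) = 0].
Proof.
case: v => x y t a0 a1 a2 /= h0 h1 h2; case: k => /=; split=> //;
by rewrite ?(DD, leibnizN, DM, leibniz_nat) ?h0 ?h1 ?h2 ?mul0r ?mulr0 ?addr0 ?oppr0.
Qed.

End LeibnizRules.

(** * Chain rules along an endomorphism *)

Section ChainRule.
Variable C : numClosedFieldType.
Local Notation K := (ratfun C).
Local Notation J := (ratcst ('i : C)).
Local Notation co := (coords C).

Lemma derivation_precomp (f d : K -> K) : endo f -> derivation_along id d ->
  derivation_along f (d \o f).
Proof.
move=> hf [da dm dc]; have [F Ff] := endo_rmorphism hf; case: hf => _ _ fc.
rewrite -Ff; split=> [a b|a b|c] /=; first by rewrite rmorphD da.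
  by rewrite rmorphM dm.
by rewrite Ff fc dc.
Qed.

Lemma derivation_postcomp (f d : K -> K) (u : K) : endo f ->
  derivation_along id d -> derivation_along f (fun z => f (d z) * u).
Proof.
move=> hf [da dm dc]; have [F Ff] := endo_rmorphism hf.
rewrite -Ff; split=> [a b|a b|c] /=; first by rewrite da rmorphD mulrDl.
  by rewrite dm rmorphD !rmorphM mulrDl mulrAC mulrA.
by rewrite dc rmorph0 mul0r.
Qed.

Lemma derivation_bigsum (f : K -> K) (d : 'I_5 -> K -> K) :
  (forall i, derivation_along f (d i)) ->
  derivation_along f (fun z => \sum_i d i z).
Proof.
move=> h; split=> [a b|a b|c].
- by rewrite -big_split; apply: eq_bigr => i _; have [-> _ _] := h i.
- rewrite mulr_suml mulr_sumr -big_split; apply: eq_bigr => i _.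
  by have [_ -> _] := h i.
- by rewrite big1 // => i _; have [_ _ ->] := h i.
Qed.

(** Both sides are derivations along [f] in [z], and they agree on the variables. *)
Lemma pderiv_chain (f : K -> K) j z : endo f ->
  pderiv j (f z) = \sum_i f (pderiv i z) * pderiv j (f (ratvar C i)).
Proof.
move=> hf; have [F Ff] := endo_rmorphism hf.
pose d z := \sum_i f (pderiv i z) * pderiv j (f (ratvar C i)).
suff /(congr1 (@^~ z)) : pderiv j \o f = d by [].
apply: (derivation_along_ext hf).
- by apply: derivation_precomp => //; apply: pderiv_derivation.
- apply: derivation_bigsum => i; apply: derivation_postcomp => //.
  exact: pderiv_derivation.
move=> i; rewrite /d (bigD1 i) //= pderiv_ratvar eqxx -Ff rmorph1 mul1r.
rewrite big1 ?addr0 // => k ki.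
by rewrite pderiv_ratvar (negbTE ki) rmorph0 mul0r.
Qed.

Lemma sum5 (F : nmodType) (u : 'I_5 -> F) :
  \sum_i u i = u xi + u yi + u ti + u a1i + u a2i.
Proof.
rewrite !big_ord_recl big_ord0 addr0 !addrA.
by do ?congr (_ + _); congr u; apply: val_inj.
Qed.

(** In the chain rule, the terms for x, y, t vanish because of [z], and those for alpha_1, alpha_2
    because of their images under [f]. *)
Lemma param_only_endo (f : K -> K) z : endo f ->
  param_only (f (ratvar C a1i)) -> param_only (f (ratvar C a2i)) ->
  param_only z -> param_only (f z).
Proof.
move=> hf [hx1 hy1 ht1] [hx2 hy2 ht2] [zx zy zt].
have [F Ff] := endo_rmorphism hf.
have f0 : f 0 = 0 by rewrite -Ff rmorph0.
by split; rewrite pderiv_chain // sum5 zx zy zt f0 !mul0r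
  ?hx1 ?hx2 ?hy1 ?hy2 ?ht1 ?ht2 !mulr0 !addr0.
Qed.

Lemma ddt_ratvar i : ddt (ratvar C i) =
  (ti == i)%:R + dxdt co * (xi == i)%:R + dydt co * (yi == i)%:R.
Proof. by rewrite /ddt !pderiv_ratvar. Qed.

Lemma ddt_coords : [/\ ddt (px co) = dxdt co, ddt (py co) = dydt co & ddt (pt co) = 1].
Proof.
by split; rewrite ddt_ratvar /=; rewrite ?(mulr0, mulr1, add0r, addr0).
Qed.

Lemma param_only_ddt (z : K) : param_only z -> ddt z = 0.
Proof. by move=> [zx zy zt]; rewrite /ddt zx zy zt !mulr0 !addr0. Qed.

(** By uniqueness of derivations along [f], it is enough to compare on variables: on x and y the
    equality is the transformed system, on t it is trivial, and on the parameters both sides are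
    0. *)
Lemma ddt_chain (f : K -> K) z : endo f -> (Backlund f) ->
  ddt (f z) = f (ddt z) * ddt (f (ratvar C ti)).
Proof.
move=> hf [_ /= [[_ h1 h2] ht hx hy]].
have [F Ff] := endo_rmorphism hf.
have [cx cy ct] := ddt_coords.
suff /(congr1 (@^~ z)) :
  @ddt C \o f = (fun z => f (ddt z) * ddt (f (ratvar C ti))) by [].
apply: (derivation_along_ext hf).
- by apply: derivation_precomp => //; apply: ddt_derivation.
- by apply: derivation_postcomp => //; apply: ddt_derivation.
apply: ord5_ind => /=.
- by rewrite -[ratvar C xi]/(px co) cx hx -Ff dxdt_rmorph.
- by rewrite -[ratvar C yi]/(py co) cy hy -Ff dydt_rmorph.
- by rewrite -[ratvar C ti]/(pt co) ct -Ff rmorph1 mul1r.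
- rewrite param_only_ddt // ddt_ratvar -Ff /= !mulr0 !addr0 rmorph0 mul0r //.
- rewrite param_only_ddt // ddt_ratvar -Ff /= !mulr0 !addr0 rmorph0 mul0r //.
Qed.

End ChainRule.

Lemma leibniz_pa0 (F : fieldType) (D : F -> F) :
  (forall a b, D (a + b) = D a + D b) -> (forall a b, D (a * b) = D a * b + a * D b) ->
  forall a b, D a = 0 -> D b = 0 -> D (1 - 2 * a - 3 * b) = 0.
Proof.
move=> DD DM a b ha hb; rewrite !DD !(leibnizN DD) !DM ha hb (leibniz1 DM).
by rewrite !(leibniz_nat DD DM) !mul0r !mulr0 !addr0 !oppr0 !addr0.
Qed.

(** * Closure properties of Bäcklund transformations *)

Section BacklundTransformations.
Variable C : numClosedFieldType.
Local Notation K := (ratfun C).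
Local Notation J := (ratcst ('i : C)).
Local Notation co := (coords C).

Lemma Backlund_endo (f : K -> K) : Backlund f -> endo f.
Proof. by move=> [[]]. Qed.

Lemma param_only_coords :
  [/\ param_only (pa0 co), param_only (pa1 co) & param_only (pa2 co)].
Proof.
have h1 : param_only (pa1 co) by split; rewrite /= pderiv_ratvar.
have h2 : param_only (pa2 co) by split; rewrite /= pderiv_ratvar.
split=> //; have h j := pderiv_derivation C j.
case: h1 h2 => x1 y1 t1 [x2 y2 t2]; split.
- by have [dD dM _] := h xi; exact: leibniz_pa0 dD dM _ _ x1 x2.
- by have [dD dM _] := h yi; exact: leibniz_pa0 dD dM _ _ y1 y2.
- by have [dD dM _] := h ti; exact: leibniz_pa0 dD dM _ _ t1 t2.
Qed.

Lemma Backlund_id : Backlund (id : K -> K).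
Proof.
have [dx dy dt] := ddt_coords C.
split; first by split=> //; exists id.
have -> : map_phase id co = co by [].
split; first exact: param_only_coords.
- by rewrite dt oner_neq0.
- by rewrite dx dt mulr1.
- by rewrite dy dt mulr1.
Qed.

Lemma Backlund_comp (f g : K -> K) : Backlund f -> Backlund g -> Backlund (f \o g).
Proof.
move=> hf hg; have ef := Backlund_endo hf; have eg := Backlund_endo hg.
have [fz fm fc] := endo_comp ef eg.
have [F Ff] := endo_rmorphism ef.
have chain z := ddt_chain z ef hf.
have fM : {morph f : a b / a * b} by rewrite -Ff; apply: rmorphM.
have fx' v : f (dxdt v) = dxdt (map_phase f v) by rewrite -Ff dxdt_rmorph.
have fy' v : f (dydt v) = dydt (map_phase f v) by rewrite -Ff dydt_rmorph.
move: hf hg => [[_ _ fb _] [[f0 f1 f2] ft _ _]].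
move=> [[_ _ gb _] []]; set v := map_phase g co => -[g0 g1 g2] gt gx gy.
split; first by split=> //; apply: bij_comp.
split.
- by split; apply: (param_only_endo ef).
- suff : ddt (f (pt v)) != 0 by [].
  by rewrite chain; apply: mulf_neq0 ft; apply: endo_inj.
(* The chain rule along [f] is applied forwards to the transformed x, and backwards to the
   transformed time to reassemble its derivative. *)
- suff : ddt (f (px v)) = dxdt (map_phase f v) * ddt (f (pt v)) by [].
  by rewrite chain gx fM fx' -mulrA -chain.
- suff : ddt (f (py v)) = dydt (map_phase f v) * ddt (f (pt v)) by [].
  by rewrite chain gy fM fy' -mulrA -chain.
Qed.

Lemma bt_dom_coords k : bt_dom k co.
Proof. by case: k => //; apply: ratvar_neq0. Qed.

(** [bt_derivation] identifies the derivatives of the new coordinates with the tangent map, for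
    which [bt_system] is the required equation. *)
Lemma Backlund_bt k (f : K -> K) : endo f -> bijective f ->
  map_phase f co = bt J k co -> Backlund f.
Proof.
move=> [fz fm fc] fb e; split; first by [].
rewrite e; set w := bt J k co.
have [p0 p1 p2] := param_only_coords.
have par j : pderiv j (pa0 co) = 0 -> pderiv j (pa1 co) = 0 -> pderiv j (pa2 co) = 0 ->
  [/\ pderiv j (pa0 w) = 0, pderiv j (pa1 w) = 0 & pderiv j (pa2 w) = 0].
  have [dD dM _] := pderiv_derivation C j.
  exact: bt_derivation_params dD dM J k co.
have [[x0 y0 t0] [x1 y1 t1] [x2 y2 t2]] := And3 p0 p1 p2.
have [X0 X1 X2] := par _ x0 x1 x2; have [Y0 Y1 Y2] := par _ y0 y1 y2.
have [T0 T1 T2] := par _ t0 t1 t2.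
have [dD dM dC] := ddt_derivation C.
have [dx dy dt] := ddt_coords C.
have : (ddt (px w), ddt (py w), ddt (pt w)) =
    bt_tangent J k co (ddt (px co)) (ddt (py co)) (ddt (pt co)).
  exact: (@bt_derivation _ _ dD dM J k co) (ratfun_two C) (dC _)
    (param_only_ddt p1) (param_only_ddt p2) (bt_dom_coords k).
have := bt_system (ratfun_two C) (ratcst_i C) (coords_constrained C) (bt_dom_coords k).
rewrite dx dy dt -/w; have : (bt_tangent J k co (dxdt co) (dydt co) 1).2 != 0.
  case: (k); rewrite /bt_tangent ?oner_neq0 //.
  by rewrite mulr1 oppr_eq0 ratcst_i_neq0.
case: (bt_tangent _ _ _ _ _ _) => [[dX dY] dT] dT0 [hX hY] [eX eY eT].
split; first by split.
- by rewrite eT.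
- rewrite eX eT; exact: hX.
- rewrite eY eT; exact: hY.
Qed.

End BacklundTransformations.

(** * Relations between the automorphisms *)

Section Words.
Variable C : numClosedFieldType.
Local Notation K := (ratfun C).
Local Notation J := (ratcst ('i : C)).
Local Notation co := (coords C).
Variable s : node -> K -> K.
Hypothesis s_endo : forall k, endo (s k).
Hypothesis s_coords : forall k, map_phase (s k) co = bt J k co.

Lemma word_act_endo w : endo (word_act s w).
Proof. by elim: w => [|k w IH]; [apply: endo_id|apply: endo_comp]. Qed.

Lemma word_act_cat u w : word_act s (u ++ w) = word_act s u \o word_act s w.
Proof. by elim: u => [|k u IH] //=; rewrite IH. Qed.

(* Substitutions compose contravariantly. *)
Lemma word_act_coords w : map_phase (word_act s w) co = foldr (bt J) co (rev w).
Proof.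
elim/last_ind: w => [//|w k IH].
rewrite rev_rcons -cats1 word_act_cat -/(bt J k _).
have -> : map_phase (word_act s w \o word_act s [:: k]) co =
  map_phase (word_act s w) (map_phase (s k) co) by [].
rewrite s_coords endo_bt ?IH //; exact: word_act_endo.
Qed.

(** Every point of the orbit is the image of the generic point under an endomorphism of a field,
    which kills no nonzero element. This supplies the hypothesis of [bt_braid12]. *)
Lemma foldr_bt_regular w :
  px (foldr (bt J) co w) != 0 /\ py (foldr (bt J) co w) != 0.
Proof.
rewrite -(revK w) -word_act_coords; have h := endo_inj (word_act_endo (rev w)).
by split; apply: h; apply: ratvar_neq0.
Qed.

Lemma word_act_eq w w' : foldr (bt J) co (rev w) = foldr (bt J) co (rev w') ->
  word_act s w = word_act s w'.
Proof.
rewrite -!word_act_coords; apply: endo_coords_ext; exact: word_act_endo.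
Qed.

Lemma word_act_00 : word_act s [:: n0; n0] = id.
Proof. by apply: (@word_act_eq _ [::]); exact: bt0K. Qed.

Lemma word_act_11 : word_act s [:: n1; n1] = id.
Proof. by apply: (@word_act_eq _ [::]); apply: bt1K; apply: ratvar_neq0. Qed.

Lemma word_act_010 : word_act s [:: n0; n1; n0] = word_act s [:: n1; n0; n1].
Proof. by apply: word_act_eq; apply: bt_braid01; apply: ratvar_neq0. Qed.

Lemma word_act_02 : word_act s [:: n0; n2] = word_act s [:: n2; n0].
Proof. by apply: word_act_eq; symmetry; apply: bt_comm02; apply: ratvar_neq0. Qed.

Lemma word_act_121212 :
  word_act s [:: n1; n2; n1; n2; n1; n2] = word_act s [:: n2; n1; n2; n1; n2; n1].
Proof.
apply: word_act_eq.
exact: bt_braid12 (ratfun_two C) (ratcst_i C) foldr_bt_regular.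
Qed.

Lemma word_act_22_coords : map_phase (word_act s [:: n2; n2]) co =
  Phase (- px co) (- py co) (- pt co) (pa0 co) (pa1 co) (pa2 co).
Proof.
rewrite word_act_coords.
exact: bt22 (ratfun_two C) (ratcst_i C) co (ratvar_neq0 _ _).
Qed.

Lemma word_act_2222 : word_act s [:: n2; n2; n2; n2] = id.
Proof.
apply: (@word_act_eq _ [::]).
rewrite -[LHS]/(iter 4 (bt J n2) co).
exact: bt_pow4 (ratfun_two C) (ratcst_i C) n2 co (px_coords_neq0 C) (py_coords_neq0 C).
Qed.

(** For [n0] this comes from commutation with [n2]; for [n1], from x + alpha_1 / y being odd in (x,
    y). *)
Lemma word_act_22_comm k :
  word_act s [:: n2; n2; k] = word_act s [:: k; n2; n2].
Proof.
case: k => //.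
- rewrite -[[:: n2; n2; n0]]/([:: n2] ++ [:: n2; n0]) word_act_cat -word_act_02.
  by rewrite -word_act_cat -[_ ++ _]/([:: n2; n0] ++ [:: n2]) word_act_cat -word_act_02.
- have h := word_act_endo; apply: endo_coords_ext => //.
  have -> : map_phase (word_act s [:: n2; n2; n1]) co =
    map_phase (word_act s [:: n2; n2]) (map_phase (s n1) co) by [].
  have -> : map_phase (word_act s [:: n1; n2; n2]) co =
    map_phase (s n1) (map_phase (word_act s [:: n2; n2]) co) by [].
  rewrite s_coords endo_bt // word_act_22_coords.
  have [F Ff] := endo_rmorphism (s_endo n1).
  have := s_coords n1; rewrite -Ff => -[ex ey et e0 e1 e2].
  rewrite /map_phase !rmorphN /= ex ey et e0 e1 e2.
  by congr (Phase _ _ _ _ _ _); rewrite opprD invrN mulrN.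
Qed.

End Words.

(** * Normal forms in the affine Weyl group *)

Section AffineWeylGroup.

Local Notation "w ~~ w'" := (weyl_eq w w') (at level 70).

Lemma weyl_cat u v w w' : w ~~ w' -> u ++ w ++ v ~~ u ++ w' ++ v.
Proof.
elim=> {w w'} [w|w w' _ IH|w1 w2 w3 _ IH1 _ IH2|u' v' i j].
- exact: weyl_refl.
- exact: weyl_sym.
- exact: weyl_trans IH1 IH2.
- by rewrite -!catA !(catA u u') ; apply: weyl_rel.
Qed.

Lemma weyl_catl u w w' : w ~~ w' -> u ++ w ~~ u ++ w'.
Proof. by move=> /(weyl_cat u [::]); rewrite !cats0. Qed.

Lemma weyl_catr v w w' : w ~~ w' -> w ++ v ~~ w' ++ v.
Proof. exact: (@weyl_cat [::] v). Qed.

(** One rewriting step inside the context [u], [v]; the derivations below are chains of such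
    steps. *)
Lemma weyl_step u v w w' z : w ~~ w' -> u ++ w' ++ v ~~ z -> u ++ w ++ v ~~ z.
Proof. by move=> /(weyl_cat u v); apply: weyl_trans. Qed.

Lemma weyl_sq k : [:: k; k] ~~ [::].
Proof.
case: k; [exact: (weyl_rel [::] [::] n0 n0) | exact: (weyl_rel [::] [::] n1 n1) |
          exact: (weyl_rel [::] [::] n2 n2)].
Qed.

Lemma weyl_rev w w' : w ~~ w' -> rev w ~~ rev w'.
Proof.
elim=> {w w'} [w|w w' _ IH|w1 w2 w3 _ IH1 _ IH2|u' v' i j].
- exact: weyl_refl.
- exact: weyl_sym.
- exact: weyl_trans IH1 IH2.
rewrite !rev_cat -catA.
have -> : rev (flatten (nseq (coxeter_G2aff i j) [:: i; j])) =
  flatten (nseq (coxeter_G2aff j i) [:: j; i]) by case: i; case: j.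
exact: weyl_rel.
Qed.

Lemma weyl_revr w : w ++ rev w ~~ [::].
Proof.
elim: w => [|k w IH]; first exact: weyl_refl.
rewrite rev_cons -cats1 catA cat_cons -cat1s -catA.
by apply: (weyl_trans (weyl_cat [:: k] [:: k] IH)); apply: weyl_sq.
Qed.

Lemma weyl_revl w : rev w ++ w ~~ [::].
Proof. by have := weyl_revr (rev w); rewrite revK. Qed.

(** As the generators are involutions, [rev] is inversion; this turns relators into commutation and
    braid relations. *)
Lemma weyl_inv u v : u ++ v ~~ [::] -> u ~~ rev v.
Proof.
move=> h; have := weyl_catl u (weyl_revr v); rewrite cats0 => /weyl_sym h'.
by apply: weyl_trans h' _; rewrite catA; exact: (weyl_catr (rev v) h).
Qed.

Lemma weyl_02 : [:: n0; n2] ~~ [:: n2; n0].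
Proof. exact: (@weyl_inv [:: n0; n2] [:: n0; n2] (weyl_rel [::] [::] n0 n2)). Qed.

Lemma weyl_010 : [:: n0; n1; n0] ~~ [:: n1; n0; n1].
Proof. exact: (@weyl_inv [:: n0; n1; n0] [:: n1; n0; n1] (weyl_rel [::] [::] n0 n1)). Qed.

Lemma weyl_12 : [:: n1; n2; n1; n2; n1; n2] ~~ [:: n2; n1; n2; n1; n2; n1].
Proof.
pose w := [:: n1; n2; n1; n2; n1; n2].
exact: (@weyl_inv w w (weyl_rel [::] [::] n1 n2)).
Qed.

(* Generators of the translation lattice, inverted by [rev]; they add multiples
   of alpha_0 + 2 alpha_1 + 3 alpha_2 to the forms below. *)
Definition tX := [:: n0; n1; n0; n2; n1; n2].
Definition tY := [:: n0; n2; n1; n2; n0; n1].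

Lemma weyl_2X : n2 :: tX ~~ tY ++ [:: n2].
Proof.
apply: (@weyl_step [::] [:: n1; n0; n2; n1; n2] _ _ _ (weyl_sym weyl_02)) => /=.
apply: (@weyl_step [:: n0; n2; n1] [:: n1; n2] _ _ _ weyl_02) => /=.
exact: weyl_refl.
Qed.

Lemma weyl_2Y : n2 :: tY ~~ tX ++ [:: n2].
Proof.
apply: (@weyl_step [::] [:: n2; n1; n2; n0; n1] _ _ _ (weyl_sym weyl_02)) => /=.
apply: (@weyl_step [:: n0] [:: n1; n2; n0; n1] _ _ _ (weyl_sq n2)) => /=.
apply: weyl_sym.
apply: (@weyl_step [:: n0; n1; n0; n2; n1] [::] _ _ _ (weyl_sq n2)) => /=.
apply: (@weyl_step [:: n0; n1] [:: n1] _ _ _ weyl_02) => /=.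
exact: weyl_refl.
Qed.

Lemma weyl_2X' : n2 :: rev tX ~~ rev tY ++ [:: n2].
Proof.
apply: (@weyl_step [::] [:: n1; n2; n0; n1; n0] _ _ _ (weyl_sq n2)) => /=.
apply: weyl_sym.
apply: (@weyl_step [:: n1; n0; n2; n1; n2] [::] _ _ _ weyl_02) => /=.
apply: (@weyl_step [:: n1; n0; n2; n1] [:: n0] _ _ _ (weyl_sq n2)) => /=.
apply: (@weyl_step [:: n1] [:: n1; n0] _ _ _ weyl_02) => /=.
exact: weyl_refl.
Qed.

Lemma weyl_2Y' : n2 :: rev tY ~~ rev tX ++ [:: n2].
Proof.
apply: (@weyl_step [:: n2; n1] [:: n1; n2; n0] _ _ _ weyl_02) => /=.
apply: weyl_sym.
apply: (@weyl_step [:: n2; n1; n2; n0; n1] [::] _ _ _ weyl_02) => /=.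
exact: weyl_refl.
Qed.

(** The word [n1 :: tY] is a palindrome, so the two sides coincide letter by letter. *)
Lemma weyl_1Y : n1 :: tY ~~ rev tY ++ [:: n1].
Proof.

exact: weyl_refl.
Qed.

Lemma weyl_1Y' : n1 :: rev tY ~~ tY ++ [:: n1].
Proof.
apply: (@weyl_step [::] [:: n0; n2; n1; n2; n0] _ _ _ (weyl_sq n1)) => /=.
apply: weyl_sym.
apply: (@weyl_step [:: n0; n2; n1; n2; n0] [::] _ _ _ (weyl_sq n1)) => /=.
exact: weyl_refl.
Qed.

(** The same word is reached from [tY ++ tX], whence commutation; it also has a single [n0], which
    can then be solved for. *)
Lemma weyl_XY : tX ++ tY ~~ [:: n0; n1; n2; n1; n2; n1].
Proof.
apply: (@weyl_step [:: n0; n1; n0; n2; n1; n2] [:: n1; n2; n0; n1] _ _ _ weyl_02) => /=.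
apply: (@weyl_step [:: n0; n1; n0; n2; n1] [:: n0; n1; n2; n0; n1] _ _ _ (weyl_sq n2)) => /=.
apply: (@weyl_step [:: n0; n1; n0; n2] [:: n2; n0; n1] _ _ _ (weyl_sym weyl_010)) => /=.
apply: (@weyl_step [:: n0; n1] [:: n0; n1; n0; n2; n0; n1] _ _ _ weyl_02) => /=.
apply: (@weyl_step [:: n0; n1; n2] [:: n1; n0; n2; n0; n1] _ _ _ (weyl_sq n0)) => /=.
apply: (@weyl_step [:: n0; n1; n2; n1] [:: n0; n1] _ _ _ weyl_02) => /=.
apply: (@weyl_step [:: n0; n1; n2; n1; n2] [:: n1] _ _ _ (weyl_sq n0)) => /=.
exact: weyl_refl.
Qed.

Lemma weyl_YX : tY ++ tX ~~ [:: n0; n1; n2; n1; n2; n1].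
Proof.
apply: (@weyl_step [:: n0; n2; n1; n2] [:: n1; n0; n2; n1; n2] _ _ _ weyl_010) => /=.
apply: (@weyl_step [:: n0; n2; n1; n2; n1; n0] [:: n0; n2; n1; n2] _ _ _ (weyl_sq n1)) => /=.
apply: (@weyl_step [:: n0; n2; n1; n2; n1] [:: n2; n1; n2] _ _ _ (weyl_sq n0)) => /=.
apply: (@weyl_step [:: n0] [:: n2] _ _ _ (weyl_sym weyl_12)) => /=.
apply: (@weyl_step [:: n0; n1; n2; n1; n2; n1] [::] _ _ _ (weyl_sq n2)) => /=.
exact: weyl_refl.
Qed.

Lemma weyl_1X : n1 :: tX ~~ (tX ++ tY) ++ [:: n1].
Proof.
apply: weyl_sym; apply: (weyl_trans (weyl_catr [:: n1] weyl_XY)); apply: weyl_sym.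
apply: (@weyl_step [::] [:: n0; n2; n1; n2] _ _ _ (weyl_sym weyl_010)) => /=.
apply: (@weyl_step [:: n0; n1] [:: n2; n1; n2] _ _ _ (weyl_sq n0)) => /=.
apply: weyl_sym; exact: (weyl_cat [:: n0; n1; n2; n1; n2] [::] (weyl_sq n1)).
Qed.

Lemma weyl_1X' : n1 :: rev tX ~~ (rev tX ++ rev tY) ++ [:: n1].
Proof.
apply: weyl_sym; apply: (weyl_trans (weyl_catr [:: n1] _)).
  by rewrite -rev_cat; apply: (weyl_rev weyl_YX).
exact: (weyl_cat [:: n1; n2; n1; n2] [::] (weyl_sym weyl_010)).
Qed.

(** The palindrome of length 5 is its own inverse, so it cancels the tail of [weyl_XY]. *)
Lemma weyl_0 : [:: n0] ~~ (tX ++ tY) ++ [:: n1; n2; n1; n2; n1].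
Proof.
apply: weyl_sym; apply: (weyl_trans (weyl_catr _ weyl_XY)).
exact: (weyl_catl [:: n0] (weyl_revr [:: n1; n2; n1; n2; n1])).
Qed.

Lemma weyl_commV u v : u ++ v ~~ v ++ u -> rev u ++ v ~~ v ++ rev u.
Proof.
move=> h.
have e1 := weyl_catl (rev u ++ v) (weyl_revr u).
have e2 := weyl_cat (rev u) (rev u) (weyl_sym h).
have e3 := weyl_catr (v ++ rev u) (weyl_revl u).
rewrite cats0 -!catA in e1 e2 e3.
exact: weyl_trans (weyl_sym e1) (weyl_trans e2 e3).
Qed.

Definition wpow (u : seq node) (n : int) : seq node :=
  match n with
  | Posz k => flatten (nseq k u)
  | Negz k => flatten (nseq k.+1 (rev u))
  end.

Lemma wpow_succ u n : u ++ wpow u n ~~ wpow u (n + 1).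
Proof.
case: n => [k|[|k]].
- by rewrite -PoszD addn1; apply: weyl_refl.
- by rewrite /= cats0; apply: weyl_revr.
- have -> : Negz k.+1 + 1 = Negz k by lia.
  rewrite -[wpow u (Negz k.+1)]/(rev u ++ wpow u (Negz k)) catA.
  exact: (weyl_catr _ (weyl_revr u)).
Qed.

Lemma wpow_pred u n : rev u ++ wpow u n ~~ wpow u (n - 1).
Proof.
case: n => [[|k]|k].
- exact: weyl_refl.
- have -> : Posz k.+1 - 1 = Posz k by lia.
  rewrite -[wpow u (Posz k.+1)]/(u ++ wpow u (Posz k)) catA.
  exact: (weyl_catr _ (weyl_revl u)).
- have -> : Negz k - 1 = Negz k.+1 by lia.
  exact: weyl_refl.
Qed.

Lemma weyl_comm_wpow u v n : u ++ v ~~ v ++ u -> u ++ wpow v n ~~ wpow v n ++ u.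
Proof.
have flat w k : u ++ w ~~ w ++ u ->
    u ++ flatten (nseq k w) ~~ flatten (nseq k w) ++ u.
  move=> h; elim: k => [|k IH] /=; first by rewrite cats0; apply: weyl_refl.
  rewrite catA; apply: (weyl_trans (weyl_catr _ h)).
  by rewrite -!catA; apply: weyl_catl.
by move=> h; case: n => k; apply: flat => //; apply/weyl_sym/weyl_commV/weyl_sym.
Qed.

(* (false, _) stands for [tX], (true, _) for [tY], and (_, true) for the inverse. *)
Definition letter_word (l : bool * bool) : seq node :=
  let u := if l.1 then tY else tX in if l.2 then rev u else u.

Definition letters_word (L : seq (bool * bool)) : seq node :=
  flatten [seq letter_word l | l <- L].

Definition expo (b : bool) (L : seq (bool * bool)) : int :=
  \sum_(l <- L) (if l.1 == b then (-1) ^+ l.2 else 0).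

Lemma letters_word_pow L :
  letters_word L ~~ wpow tX (expo false L) ++ wpow tY (expo true L).
Proof.
have XY : tX ++ tY ~~ tY ++ tX := weyl_trans weyl_XY (weyl_sym weyl_YX).
elim: L => [|[b e] L IH]; first by rewrite /expo !big_nil; apply: weyl_refl.
apply: (weyl_trans (weyl_catl (letter_word (b, e)) IH)).
rewrite /expo !big_cons -!/(expo _ L) /= catA.
case: b => /=; last first.
  rewrite add0r; apply: weyl_catr; rewrite addrC; case: e; rewrite ?expr1 ?expr0.
    exact: wpow_pred.
  exact: wpow_succ.
rewrite add0r addrC; apply: (@weyl_trans _ (wpow tX (expo false L) ++
    letter_word (true, e) ++ wpow tY (expo true L))).
  rewrite catA; apply: weyl_catr; apply: weyl_comm_wpow; case: e; last exact: weyl_sym.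
  exact/weyl_commV/weyl_sym.
apply: weyl_catl; case: e; rewrite ?expr1 ?expr0.
  exact: wpow_pred.
exact: wpow_succ.
Qed.

(** The letters of the conjugate of [l] by [k]; the value at [n0] is a dummy, as the lemmas about it
    assume [k <> n0]. *)
Definition conj_letter (k : node) (l : bool * bool) : seq (bool * bool) :=
  match k, l with
  | n2, (b, e) => [:: (~~ b, e)]
  | n1, (true, e) => [:: (true, ~~ e)]
  | n1, (false, e) => [:: (false, e); (true, e)]
  | n0, _ => [::]
  end.

Lemma conj_letterP k l : k <> n0 ->
  k :: letter_word l ~~ letters_word (conj_letter k l) ++ [:: k].
Proof.
move: l => [[] []]; case: k => // _; rewrite /letters_word /= ?cats0.
- exact: weyl_1Y'.
- exact: weyl_2Y'.
- exact: weyl_1Y.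
- exact: weyl_2Y.
- exact: weyl_1X'.
- exact: weyl_2X'.
- exact: weyl_1X.
- exact: weyl_2X.
Qed.

Lemma conj_letters k L : k <> n0 -> exists L',
  k :: letters_word L ~~ letters_word L' ++ [:: k].
Proof.
move=> k0; elim: L => [|l L [L' IH]]; first by exists [::]; apply: weyl_refl.
exists (conj_letter k l ++ L').
rewrite /letters_word map_cat flatten_cat -!/(letters_word _).
rewrite -[k :: _]/((k :: letter_word l) ++ letters_word L) -!catA.
apply: (weyl_trans (weyl_catr _ (conj_letterP l k0))).
by rewrite -catA; apply: weyl_catl.
Qed.

Definition dihedral_words : seq (seq node) := [::
  [::]; [:: n1]; [:: n2]; [:: n1; n2]; [:: n2; n1]; [:: n1; n2; n1]; [:: n2; n1; n2];
  [:: n1; n2; n1; n2]; [:: n2; n1; n2; n1]; [:: n1; n2; n1; n2; n1];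
  [:: n2; n1; n2; n1; n2]; [:: n1; n2; n1; n2; n1; n2]].

Definition normal_form w := exists L i, (i < 12)%N /\
  w ~~ letters_word L ++ nth [::] dihedral_words i.

Lemma dihedral_mul k i : k <> n0 -> (i < 12)%N -> exists j, (j < 12)%N /\
  k :: nth [::] dihedral_words i ~~ nth [::] dihedral_words j.
Proof.
have cancel l u : l :: l :: u ~~ u := weyl_catr u (weyl_sq l).
have flip : n2 :: [:: n1; n2; n1; n2; n1; n2] ~~ [:: n1; n2; n1; n2; n1].
  by apply: (weyl_trans (weyl_catl [:: n2] weyl_12)); apply: cancel.
(* The two lists are the tables of left multiplication by [n1] and by [n2] on the indices of
   [dihedral_words]. *)
move=> k0 lt_i; exists (nth 0%N (if k is n1 then [:: 1; 0; 3; 2; 5; 4; 7; 6; 9; 8; 11; 10]%N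
                                 else [:: 2; 4; 0; 6; 1; 8; 3; 10; 5; 11; 7; 9]%N) i).
do 12?[case: i lt_i => [_|i lt_i]] => //.
all: case: k k0 => // _; split=> //=.
all: first [exact: weyl_refl | exact: cancel | exact: flip | exact: weyl_sym weyl_12].
Qed.

Lemma normal_form_eq w w' : w ~~ w' -> normal_form w' -> normal_form w.
Proof. by move=> e [L [i [hi h]]]; exists L, i; split=> //; apply: weyl_trans h. Qed.

Lemma normal_form_cons k w : k <> n0 -> normal_form w -> normal_form (k :: w).
Proof.
move=> k0 [L [i [hi h]]]; have [L' hL'] := conj_letters L k0.
have [j [hj e]] := dihedral_mul k0 hi; exists L', j; split=> //.
apply: (weyl_trans (weyl_catl [:: k] h)).
apply: (weyl_trans (weyl_catr _ hL')); rewrite -catA; exact: weyl_catl.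
Qed.

Lemma normal_form_letters L w : normal_form w -> normal_form (letters_word L ++ w).
Proof.
move=> [L' [i [hi h]]]; exists (L ++ L'), i; split=> //.
by rewrite /letters_word map_cat flatten_cat -catA; apply: weyl_catl.
Qed.

Lemma weyl_normal_form w : normal_form w.
Proof.
elim: w => [|k w IH]; first by exists [::], 0%N; split=> //; apply: weyl_refl.
case: k; [|by apply: normal_form_cons..].
(* A leading [n0] is traded for two letters and five reflections among [n1], [n2], which the
   previous lemmas absorb. *)
apply: normal_form_eq (weyl_catr w weyl_0) _; rewrite -catA.
rewrite -[tX ++ tY]/(letters_word [:: (false, false); (true, false)]).
by apply: normal_form_letters; do 5!apply: normal_form_cons => //.
Qed.

(* The action on the integer form m_0 alpha_0 + m_1 alpha_1 + m_2 alpha_2. *)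
Definition reflect_form (k : node) (m : int * int * int) : int * int * int :=
  let: (m0, m1, m2) := m in
  match k with
  | n0 => (m1 - m0, m1, m2)
  | n1 => (m0, m0 - m1 + m2, m2)
  | n2 => (m0, m1, 3 * m1 - m2)
  end.

Definition form_act (w : seq node) (m : int * int * int) := foldr reflect_form m w.

Lemma eq_form (x y z x' y' z' : int) :
  x = x' -> y = y' -> z = z' -> (x, y, z) = (x', y', z').
Proof. by move=> -> -> ->. Qed.

Lemma form_act_sq k m : reflect_form k (reflect_form k m) = m.
Proof. by case: m k => [[m0 m1] m2] []; apply: eq_form; lia. Qed.

Lemma form_act_cat u v m : form_act (u ++ v) m = form_act u (form_act v m).
Proof. exact: foldr_cat. Qed.

Lemma form_act_weyl w w' m : w ~~ w' -> form_act w m = form_act w' m.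
Proof.
move=> h; elim: h m => {w w'} [//|w w' _ IH m|w1 w2 w3 _ IH1 _ IH2 m|u v i j m].
- by rewrite IH.
- by rewrite IH1.
rewrite !form_act_cat; congr form_act.
case: (form_act v m) => [[m0 m1] m2]; case: i; case: j; try exact: form_act_sq.
all: by apply: eq_form; lia.
Qed.

(** Adds [c] times the null root (1, 2, 3). Both coefficients in [c] are linear forms vanishing on
    the null root, so that translations compose by adding [a] and [b]. *)
Definition translate_form (a b : int) (m : int * int * int) :=
  let: (m0, m1, m2) := m in
  let c := a * (m0 + m1 - m2) + b * (m0 - 2 * m1 + m2) in
  (m0 + c, m1 + 2 * c, m2 + 3 * c).

Lemma form_act_letter l m : form_act (letter_word l) m =
  if l.1 then translate_form 0 ((-1) ^+ l.2) m else translate_form ((-1) ^+ l.2) 0 m.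
Proof. by case: m l => [[m0 m1] m2] [[] []]; apply: eq_form; rewrite /=; lia. Qed.

Lemma form_act_letters L m :
  form_act (letters_word L) m = translate_form (expo false L) (expo true L) m.
Proof.
elim: L m => [|[b e] L IH] [[m0 m1] m2].
  by rewrite /expo !big_nil; apply: eq_form; lia.
rewrite /letters_word /= form_act_cat IH form_act_letter /expo !big_cons -!/(expo _ L).
move: (expo false L) (expo true L) ((-1) ^+ e) => a c d.
by case: b => /=; apply: eq_form; ring.
Qed.

Lemma form_act_faithful w : form_act w (0, 1, 0) = (0, 1, 0) ->
  form_act w (0, 0, 1) = (0, 0, 1) -> w ~~ [::].
Proof.
have [L [i [hi h]]] := weyl_normal_form w.
rewrite !(form_act_weyl _ h) !form_act_cat !form_act_letters.
have ep := letters_word_pow L; move: ep h.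
move: (expo false L) (expo true L) => a b ep h.
do 12?[case: i hi h => [_|i hi] h] => //; rewrite /=.
(* For the 11 nontrivial dihedral words the equations have no integer solution. For the empty one
   they amount to a = 2b and a = b. *)
all: case=> h1 h2 h3; case=> h4 h5 h6; try lia.
have a0 : a = 0 by lia.
have b0 : b = 0 by lia.
rewrite a0 b0 in ep; rewrite cats0 in h; exact: weyl_trans h ep.
Qed.

Lemma weyl_faithful w w' :
  (forall m, form_act w m = form_act w' m) -> w ~~ w'.
Proof.
move=> e; have sq m : form_act (rev w') (form_act w m) = m.
  by rewrite e -form_act_cat (form_act_weyl m (weyl_revl w')).
have h : rev w' ++ w ~~ [::] by apply: form_act_faithful; rewrite form_act_cat sq.
have h1 := weyl_catl w' h; rewrite cats0 catA in h1.
exact: weyl_trans (weyl_sym (weyl_catr w (weyl_revr w'))) h1.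
Qed.

End AffineWeylGroup.

(** * The group of transformations *)

Section Forms.
Variable F : fieldType.

Definition eval_form (v : phase F) (m : int * int * int) : F :=
  m.1.1%:~R * pa0 v + m.1.2%:~R * pa1 v + m.2%:~R * pa2 v.

Lemma eval_form_bt (I : F) k v m :
  eval_form (bt I k v) m = eval_form v (reflect_form k m).
Proof.
case: v m k => x y t a0 a1 a2 [[m0 m1] m2] []; rewrite /eval_form /=;
by rewrite ?(rmorphB, rmorphD, rmorphM) /=; ring.
Qed.

Lemma eval_form_rmorph (G : {rmorphism F -> F}) v m :
  G (eval_form v m) = eval_form (map_phase G v) m.
Proof. by rewrite /eval_form !rmorphD !rmorphM !rmorph_int. Qed.

Lemma leibniz_form (D : F -> F) (c0 c1 c2 a b : F) :
  (forall a b, D (a + b) = D a + D b) -> (forall a b, D (a * b) = D a * b + a * D b) ->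
  D c0 = 0 -> D c1 = 0 -> D c2 = 0 ->
  D (c0 * (1 - 2 * a - 3 * b) + c1 * a + c2 * b) =
  (c1 - 2 * c0) * D a + (c2 - 3 * c0) * D b.
Proof.
move=> DD DM h0 h1 h2; rewrite !DD !DM !DD !(leibnizN DD) !DM h0 h1 h2 (leibniz1 DM).
by rewrite !(leibniz_nat DD DM); ring.
Qed.

Lemma form_expand (c0 c1 c2 a b : F) :
  c0 * (1 - 2 * a - 3 * b) + c1 * a + c2 * b =
  c0 + (c1 - 2 * c0) * a + (c2 - 3 * c0) * b.
Proof. by ring. Qed.

End Forms.

Section Presentation.
Variable C : numClosedFieldType.
Local Notation K := (ratfun C).
Local Notation J := (ratcst ('i : C)).
Local Notation co := (coords C).

Lemma ratfun_int (z : int) : z%:~R = ratcst (z%:~R : C) :> K.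
Proof. by rewrite /ratcst !rmorph_int. Qed.

Lemma ratfun_intr_inj : injective (fun z : int => z%:~R : K).
Proof.
move=> a b /eqP; rewrite !ratfun_int /ratcst tofrac_eq mpoly.mpolyC_eq => /eqP.
exact: intr_inj.
Qed.

(** With alpha_0 eliminated, the partial derivatives in alpha_1 and alpha_2 give m_1 - 2 m_0 and m_2
    - 3 m_0, and the constant term left over gives m_0. *)
Lemma eval_form_inj : injective (eval_form co).
Proof.
move=> [[m0 m1] m2] [[p0 p1] p2]; rewrite /eval_form /= => e.
have cst i (z : int) : pderiv i (z%:~R : K) = 0.
  by have [_ _ h] := pderiv_derivation C i; rewrite ratfun_int.
have D i := congr1 (pderiv i) e.
have [dD dM _] := pderiv_derivation C a1i.
have [dD' dM' _] := pderiv_derivation C a2i.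
have := D a1i; rewrite !(leibniz_form _ _ dD dM) // !pderiv_ratvar.
rewrite !mulr1 !mulr0 !addr0 => e1.
have := D a2i; rewrite !(leibniz_form _ _ dD' dM') // !pderiv_ratvar.
rewrite !mulr1 !mulr0 !add0r => e2.
move: e; rewrite !form_expand e1 e2 => /addIr/addIr/ratfun_intr_inj e0.
have inj := ratfun_intr_inj.
move: e1; rewrite e0 => /addIr/inj ->.
by move: e2; rewrite e0 => /addIr/inj ->.
Qed.

Variable s : node -> K -> K.
Hypothesis s_endo : forall k, endo (s k).
Hypothesis s_coords : forall k, map_phase (s k) co = bt J k co.

Lemma word_act_form w m : word_act s w (eval_form co m) = eval_form co (form_act w m).
Proof.
elim: w m => [//|k w IH] m; transitivity (s k (word_act s w (eval_form co m))) => //; rewrite IH.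
have [G Gf] := endo_rmorphism (s_endo k).
by rewrite -Gf eval_form_rmorph Gf s_coords eval_form_bt.
Qed.

Lemma endo_form (f : K -> K) m : endo f ->
  f (eval_form co m) =
  m.1.1%:~R * f (pa0 co) + m.1.2%:~R * f (pa1 co) + m.2%:~R * f (pa2 co).
Proof.
move=> /endo_rmorphism[G <-].
by rewrite eval_form_rmorph.
Qed.

Lemma same_params_weyl w w' :
  same_params (word_act s w) (word_act s w') -> weyl_eq w w'.
Proof.
move=> [h0 h1 h2]; apply: weyl_faithful => m; apply: eval_form_inj.
rewrite -!word_act_form !endo_form ?h0 ?h1 ?h2 //; exact: word_act_endo.
Qed.

Let A := word_act s.

Lemma word_act_step u v w w' f :
  A w = A w' -> A (u ++ w' ++ v) = f -> A (u ++ w ++ v) = f.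
Proof. by rewrite /A !word_act_cat => ->. Qed.

Lemma word_act_central w : A ([:: n2; n2] ++ w) = A (w ++ [:: n2; n2]).
Proof.
elim: w => [//|k w IH].
rewrite -[_ ++ _]/([:: n2; n2; k] ++ w) /A word_act_cat word_act_22_comm // -word_act_cat.
by rewrite -[_ ++ w]/([:: k] ++ ([:: n2; n2] ++ w)) word_act_cat -/A IH /A -word_act_cat.
Qed.

Local Notation c := (A [:: n2; n2]).

Lemma word_act_pull u v f :
  A (u ++ v ++ [:: n2; n2]) = f -> A (u ++ [:: n2; n2] ++ v) = f.
Proof. by move <-; rewrite /A !(word_act_cat _ u) -/A word_act_central. Qed.

Lemma word_act_drop4 u f : A u = f -> A (u ++ [:: n2; n2; n2; n2]) = f.
Proof. by move <-; rewrite /A word_act_cat word_act_2222. Qed.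

(** The value is [c] exactly for the relators that involve [n2]: they reduce to s_2^2 or s_2^6,
    which both equal [c]. *)
Lemma word_act_relator i j :
  A (flatten (nseq (coxeter_G2aff i j) [:: i; j])) = id \/
  A (flatten (nseq (coxeter_G2aff i j) [:: i; j])) = c.
Proof.
have e00 : A [:: n0; n0] = A [::] := word_act_00 s_endo s_coords.
have e11 : A [:: n1; n1] = A [::] := word_act_11 s_endo s_coords.
have e02 := word_act_02 s_endo s_coords; have e010 := word_act_010 s_endo s_coords.
have e12 := word_act_121212 s_endo s_coords.
case: i; case: j.
- left.
  apply: (@word_act_step [::] [::] _ _ _ (e00)).
  by [].
- left.
  apply: (@word_act_step [::] [:: n1; n0; n1] _ _ _ (e010)).
  apply: (@word_act_step [:: n1; n0] [:: n0; n1] _ _ _ (e11)).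
  apply: (@word_act_step [:: n1] [:: n1] _ _ _ (e00)).
  apply: (@word_act_step [::] [::] _ _ _ (e11)).
  by [].
- right.
  apply: (@word_act_step [:: n0; n2] [::] _ _ _ (e02)).
  apply: (@word_act_pull [:: n0] [:: n0] _).
  apply: (@word_act_step [::] [:: n2; n2] _ _ _ (e00)).
  by [].
- left.
  apply: (@word_act_step [::] [:: n0; n1; n0] _ _ _ (esym e010)).
  apply: (@word_act_step [:: n0; n1] [:: n1; n0] _ _ _ (e00)).
  apply: (@word_act_step [:: n0] [:: n0] _ _ _ (e11)).
  apply: (@word_act_step [::] [::] _ _ _ (e00)).
  by [].
- left.
  apply: (@word_act_step [::] [::] _ _ _ (e11)).
  by [].
- right.
  (* The braid relation makes the word a palindrome, which collapses from the middle: pairs of [n1]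
     cancel, and pairs of [n2], being central, move to the right end. *)
  apply: (@word_act_step [:: n1; n2; n1; n2; n1; n2] [::] _ _ _ (e12)).
  apply: (@word_act_pull [:: n1; n2; n1; n2; n1] [:: n1; n2; n1; n2; n1] _).
  apply: (@word_act_step [:: n1; n2; n1; n2] [:: n2; n1; n2; n1; n2; n2] _ _ _ (e11)).
  apply: (@word_act_pull [:: n1; n2; n1] [:: n1; n2; n1; n2; n2] _).
  apply: (@word_act_step [:: n1; n2] [:: n2; n1; n2; n2; n2; n2] _ _ _ (e11)).
  apply: (@word_act_pull [:: n1] [:: n1; n2; n2; n2; n2] _).
  apply: (@word_act_step [::] [:: n2; n2; n2; n2; n2; n2] _ _ _ (e11)).
  apply: (@word_act_drop4 [:: n2; n2] _).
  by [].
- right.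
  apply: (@word_act_step [::] [:: n2; n0] _ _ _ (esym e02)).
  apply: (@word_act_pull [:: n0] [:: n0] _).
  apply: (@word_act_step [::] [:: n2; n2] _ _ _ (e00)).
  by [].
- right.
  apply: (@word_act_step [::] [:: n2; n1; n2; n1; n2; n1] _ _ _ (esym e12)).
  apply: (@word_act_pull [:: n1; n2; n1; n2; n1] [:: n1; n2; n1; n2; n1] _).
  apply: (@word_act_step [:: n1; n2; n1; n2] [:: n2; n1; n2; n1; n2; n2] _ _ _ (e11)).
  apply: (@word_act_pull [:: n1; n2; n1] [:: n1; n2; n1; n2; n2] _).
  apply: (@word_act_step [:: n1; n2] [:: n2; n1; n2; n2; n2; n2] _ _ _ (e11)).
  apply: (@word_act_pull [:: n1] [:: n1; n2; n2; n2; n2] _).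
  apply: (@word_act_step [::] [:: n2; n2; n2; n2; n2; n2] _ _ _ (e11)).
  apply: (@word_act_drop4 [:: n2; n2] _).
  by [].
- by right.
Qed.

(** Since [c \o c = id], equality up to [c] is symmetric and transitive; centrality of [c] carries
    it out of the middle of a word. *)
Lemma weyl_word_act w w' : weyl_eq w w' -> A w = A w' \/ A w = A w' \o c.
Proof.
have cc : c \o c = id by exact: (word_act_2222 s_endo s_coords).
elim=> {w w'} [w|w w' _ IH|w1 w2 w3 _ IH1 _ IH2|u v i j].
- by left.
- case: IH => ->; first by left.
  by right; rewrite -compA cc.
- case: IH1 IH2 => -> [] ->; [by left|by right|by right|].
  by left; rewrite -compA cc.
have [h|h] := word_act_relator i j; [left|right].
  by rewrite /A !word_act_cat -/A h.
have h' : A (u ++ v ++ [:: n2; n2]) = A (u ++ v) \o c by rewrite catA /A word_act_cat.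
rewrite -h'; apply: (@word_act_step u v _ [:: n2; n2]) => //.
exact: word_act_pull.
Qed.

Lemma same_params_comp_c w : same_params (A w \o c) (A w).
Proof.
have := word_act_22_coords s_endo s_coords => -[_ _ _ e0 e1 e2].
by split; rewrite /= ?e0 ?e1 ?e2.
Qed.

Lemma weyl_same_params w w' : weyl_eq w w' -> same_params (A w) (A w').
Proof. by move=> /weyl_word_act[] ->; last exact: same_params_comp_c. Qed.

Lemma word_act_inverse w : exists w', A w' \o A w = id.
Proof.
elim: w => [|k w [w' IH]]; first by exists [::].
have [u hu] : exists u, A u \o s k = id.
  case: k; [exists [:: n0]|exists [:: n1]|exists [:: n2; n2; n2]].
  - exact: (word_act_00 s_endo s_coords).
  - exact: (word_act_11 s_endo s_coords).
  - exact: (word_act_2222 s_endo s_coords).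
exists (w' ++ u); rewrite /A word_act_cat -/A.
have -> : (A w' \o A u) \o A (k :: w) = A w' \o (A u \o s k) \o A w by [].
by rewrite hu.
Qed.

Lemma generated_word g : generated s g <-> exists w, g = A w.
Proof.
split.
  elim=> {g} [k||f g _ [w ->] _ [w' ->]|f g _ [w ->] fg gf].
  - by exists [:: k].
  - by exists [::].
  - by exists (w ++ w'); rewrite /A word_act_cat.
  - have [w' h] := word_act_inverse w; exists w'; apply/funext => z.
    by rewrite -{2}(gf z) -[RHS]/((A w' \o A w) (g z)) h.
move=> [w ->]; elim: w => [|k w IH]; first exact: generated_id.
by apply: generated_comp IH; apply: generated_gen.
Qed.

(** Left inverses suffice: a left inverse of the left inverse of [s k] must be [s k] itself. *)
Lemma s_bijective k : bijective (s k).
Proof.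
have [u hu] := word_act_inverse [:: k]; have [w hw] := word_act_inverse u.
have e : A w = s k.
  have : A w \o (A u \o A [:: k]) = (A w \o A u) \o A [:: k] by [].
  by rewrite hu hw.
exists (A u) => z; first exact: (congr1 (@^~ z) hu).
by rewrite -e; exact: (congr1 (@^~ z) hw).
Qed.

Lemma generated_Backlund g : generated s g -> Backlund g.
Proof.
move=> /generated_word[w ->]; elim: w => [|k w IH]; first exact: Backlund_id.
apply: Backlund_comp IH; exact: Backlund_bt (s_endo k) (s_bijective k) (s_coords k).
Qed.

Lemma word_act_c_neq : c <> id.
Proof.
move=> h; have := word_act_22_coords s_endo s_coords; rewrite -/A h => -[].
move=> /esym/eqP; rewrite -subr_eq0 -opprD oppr_eq0 -mulr2n -mulr_natl mulf_eq0.
by rewrite (negbTE (ratfun_two C)) (negbTE (ratvar_neq0 _ _)).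
Qed.

Lemma presentation : extended_affine_Weyl_G2 s.
Proof.
split.
- split.
  + exact: (word_act_00 s_endo s_coords).
  + exact: (word_act_11 s_endo s_coords).
  + exact: (word_act_010 s_endo s_coords).
  + exact: (word_act_02 s_endo s_coords).
  + exact: (word_act_121212 s_endo s_coords).
- split.
  + exact: (word_act_22_coords s_endo s_coords).
  + exact: word_act_c_neq.
  + exact: (word_act_2222 s_endo s_coords).
  + move=> g /generated_word[w ->].
    by have := word_act_central w; rewrite /A !word_act_cat.
- exact: generated_word.
- move=> w w'; split; first exact: weyl_word_act.
  move=> h; apply: same_params_weyl; case: h => ->; first by split.
  exact: same_params_comp_c.
- move=> w w'; split; [exact: weyl_same_params|exact: same_params_weyl].
Qed.

End Presentation.

(** * Solutions *)

Section ComplexDerivatives.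
Variable C : numClosedFieldType.
Implicit Types (f g : C -> C) (t d e c : C).

Lemma is_derive_mul f g t d e : is_derive t (1 : C) f d -> is_derive t (1 : C) g e ->
  is_derive t (1 : C) (fun z => f z * g z) (d * g t + f t * e).
Proof.
move=> hf hg; apply: (is_derive_eq (is_deriveM hf hg)).
by rewrite addrC; congr (_ + _); exact: mulrC.
Qed.

Lemma is_derive_add f g t d e : is_derive t (1 : C) f d -> is_derive t (1 : C) g e ->
  is_derive t (1 : C) (fun z => f z + g z) (d + e).
Proof. by move=> hf hg; exact: is_deriveD. Qed.

Lemma is_derive_opp f t d : is_derive t (1 : C) f d ->
  is_derive t (1 : C) (fun z => - f z) (- d).
Proof. by move=> hf; exact: is_deriveN. Qed.

Lemma is_derive_const c t : is_derive t (1 : C) (fun _ => c) 0.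
Proof. exact: is_derive_cst. Qed.

Lemma is_derive_exp n f t d : is_derive t (1 : C) f d ->
  is_derive t (1 : C) (fun z => f z ^+ n.+1) (n.+1%:R * f t ^+ n * d).
Proof.
move=> hf; elim: n => [|n IH]; first by rewrite expr0 mulr1 mul1r.
have := is_derive_mul hf IH; rewrite (_ : (fun z => f z * _) = (fun z => f z ^+ n.+2)).
  by move=> h; apply: (is_derive_eq h); rewrite [in RHS]mulrS !exprS; ring.
by apply/funext => z; rewrite -exprS.
Qed.

Lemma is_derive_inv f t d : f t != 0 -> is_derive t (1 : C) f d ->
  is_derive t (1 : C) (fun z => (f z)^-1) (- d / f t ^+ 2).
Proof.
move=> f0 [hf <-]; apply: DeriveDef; first exact: derivableV.
by rewrite deriveV // scaleNr mulNr; congr (- _); exact: mulrC.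
Qed.

Lemma is_derive_compose f g t d e : is_derive (g t) (1 : C) f d ->
  is_derive t (1 : C) g e -> is_derive t (1 : C) (fun z => f (g z)) (e * d).
Proof.
move=> [hf <-] [hg <-].
have df : differentiable f (g t) := (derivable1_diffP _ _).1 hf.
have dg : differentiable g t := (derivable1_diffP _ _).1 hg.
(* In dimension one a differential is multiplication by its value at 1, so composition of
   differentials becomes a product of derivatives. *)
have lin (u : C) : 'd f (g t) u = u * 'd f (g t) (1 : C).
  rewrite -{1}[u]mulr1; exact: linearZ.
have dfg : differentiable (f \o g) t := differentiable_comp dg df.
apply: DeriveDef; first exact: (derivable1_diffP _ _).2 dfg.
transitivity ('D_(1 : C) (f \o g) t); first by [].
rewrite (deriveE _ dfg) (diff_comp dg df) /= (deriveE _ df) (deriveE _ dg).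
exact: lin.
Qed.

Lemma is_derive_scale f c t d : is_derive (c * t) (1 : C) f d ->
  is_derive t (1 : C) (fun z => f (c * z)) (c * d).
Proof.
move=> hf; apply: (@is_derive_compose f (fun z => c * z) t d c hf).
apply: (is_derive_eq (is_derive_mul (is_derive_const c t) (is_derive_id t (1 : C)))).
by rewrite mul0r add0r mulr1.
Qed.

Lemma open_scale (U : set C) (e : C) : e != 0 -> open U -> open (( *%R e) @` U).
Proof.
move=> e0 oU; have -> : ( *%R e) @` U = ( *%R e^-1) @^-1` U.
  apply/seteqP; split=> [_ [z Uz <-]|z Uz] /=; first by rewrite mulKf.
  by exists (e^-1 * z) => //; rewrite mulVKf.
by apply: open_comp => // z _; exact: (@scaler_continuous C C e^-1).
Qed.

Lemma is_derive_bt (I : C) k (x y : C -> C) t dx dy a0 a1 a2 :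
  let curve t := Phase (x t) (y t) t a0 a1 a2 in
  is_derive t (1 : C) x dx -> is_derive t (1 : C) y dy -> bt_dom k (curve t) ->
  let d := bt_tangent I k (curve t) dx dy 1 in
  is_derive t (1 : C) (fun t => px (bt I k (curve t))) d.1.1 /\
  is_derive t (1 : C) (fun t => py (bt I k (curve t))) d.1.2.
Proof.
move=> curve hx hy; have cst c := is_derive_const c t.
have two : (2 : C) != 0 by rewrite pnatr_eq0.
case: k => dom; split; try assumption.
- apply: (is_derive_eq (is_derive_add hx (is_derive_mul (cst a1) (is_derive_inv dom hy)))).
  by rewrite mul0r add0r mulrA mulrN mulNr.
- by apply: (is_derive_eq (is_derive_mul (cst I) hx)); rewrite mul0r add0r.
have ht := is_derive_id t (1 : C).
have x0 n : x t ^+ n != 0 by rewrite expf_neq0.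
have h3 := is_derive_opp (is_derive_mul (cst (3 * a2)) (is_derive_inv dom hx)).
have h2 := is_derive_mul ht (@is_derive_inv (fun z => x z ^+ 2) _ _ (x0 2%N) (is_derive_exp 1 hx)).
have x3 : 2 * x t ^+ 3 != 0 by rewrite mulf_neq0.
have h1 := is_derive_mul (cst 1)
  (@is_derive_inv (fun z => 2 * x z ^+ 3) _ _ x3 (is_derive_mul (cst 2) (is_derive_exp 2 hx))).
apply: (is_derive_eq (is_derive_mul (cst (- I))
  (is_derive_add (is_derive_add (is_derive_add hy h3) h2) h1))).
by rewrite /= /id; field.
Qed.

End ComplexDerivatives.

Section Solutions.
Variable C : numClosedFieldType.

Definition time_scale (k : node) : C := if k is n2 then - 'i else 1.

Lemma time_scale_neq0 k : time_scale k != 0.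
Proof. by case: k; rewrite /= ?oppr_eq0 ?neq0Ci ?oner_neq0. Qed.

Lemma bt_tangent_time (I : C) k v dx dy :
  (bt_tangent 'i k v dx dy 1).2 = time_scale k.
Proof. by case: v k => x y t a0 a1 a2 [] //=; rewrite mulr1. Qed.

(** The new time is the old one times a nonzero constant [e], so the new solution is the transformed
    curve precomposed with multiplication by [e^-1]. Its derivative gains the factor [e^-1], which
    cancels the dT of [bt_system]. *)
Lemma bt_carries_solutions k : @carries_solutions C (bt 'i k) (bt_dom k).
Proof.
move=> U a0 a1 a2 x y curve time ha [oU hU] dom.
have h2 : (2 : C) != 0 by rewrite pnatr_eq0.
pose e := time_scale k; have e0 : e != 0 := time_scale_neq0 k.
have timeE t : time t = e * t.
  by rewrite /time /e; case: (k) => /=; rewrite ?mul1r.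
pose g t := bt 'i k (curve t).
pose X z := px (g (e^-1 * z)); pose Y z := py (g (e^-1 * z)).
(* The new parameters are constant along the curve; reading them at 0 is legitimate even when 0 lies
   outside [U]. *)
have gE t : g t = Phase (X (time t)) (Y (time t)) (time t)
    (pa0 (g 0)) (pa1 (g 0)) (pa2 (g 0)).
  by rewrite /X /Y timeE mulKf // -timeE /g /time; case: (k).
have imE : time @` U = ( *%R e) @` U by congr (_ @` U); apply/funext.
exists (pa0 (g 0)), (pa1 (g 0)), (pa2 (g 0)), X, Y; split.
- exact: (@bt_constrained _ _ k (curve 0)).
- split; first by rewrite imE; apply: open_scale.
  rewrite imE => _ [t Ut <-]; have [hx hy] := hU t Ut.
  have [hX hY] := is_derive_bt 'i hx hy (dom t Ut).
  have := @bt_system _ 'i k (curve t) h2 (sqrCi C) ha (dom t Ut).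
  have := bt_tangent_time 'i k (curve t) (dxdt (curve t)) (dydt (curve t)).
  move: hX hY; case: (bt_tangent _ _ _ _ _ _) => [[dX dY] dT] hX hY hT [eX eY].
  have {}hT : dT = e := hT.
  rewrite -(timeE t) -(gE t); split.
  + have := @is_derive_scale _ (fun t => px (g t)) e^-1 (e * t) dX.
    rewrite mulKf // timeE => /(_ hX) h; apply: (is_derive_eq h).
    by rewrite eX hT mulrC mulfK.
  + have := @is_derive_scale _ (fun t => py (g t)) e^-1 (e * t) dY.
    rewrite mulKf // timeE => /(_ hY) h; apply: (is_derive_eq h).
    by rewrite eY hT mulrC mulfK.
- by move=> t _; exact: gE.
Qed.

End Solutions.

Theorem theorem2p1 (R : realType) :
  (forall k : node, @carries_solutions R[i] (bt 'i%R k) (bt_dom k)) /\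
  exists s : node -> ratfun R[i] -> ratfun R[i],
    [/\ forall k, map_phase (s k) (coords R[i]) = bt (ratcst 'i%R) k (coords R[i]),
        forall g, generated s g -> Backlund g &
        extended_affine_Weyl_G2 s].
Proof.
split; first exact: bt_carries_solutions.
have [s hs] := choice (@endo_bt_exists R[i]).
exists s; split.
- by move=> k; have [] := hs k.
- by apply: generated_Backlund => k; have [] := hs k.
- by apply: presentation => k; have [] := hs k.
Qed.
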